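(* Let $NS_2=\langle a,b\mid bab^{-1}a\rangle$ be the Klein bottle group, and let $G=G_1\times\cdots\times G_n$ ($n\geq 1$), where each $G_i$ is a surface group of Euclidean type, i.e., each $G_i$ is one of $1$, $\mathbb{Z}$, $\mathbb{Z}^2$, $\mathbb{Z}/2\mathbb{Z}$, $NS_2$. Then the following are equivalent: (a) $\mathrm{Fix}\,\phi$ is compressed in $G$ for every endomorphism $\phi\in\mathrm{End}(G)$; (b) $\mathrm{Fix}\,\phi$ is compressed in $G$ for every automorphism $\phi\in\mathrm{Aut}(G)$; (c) $G$ is (isomorphic to a group) of one of the following forms: (euc1) $\mathbb{Z}^p\times(\mathbb{Z}/2\mathbb{Z})^q$ for some $p,q\geq 0$; or (euc2) $NS_2\times(\mathbb{Z}/2\mathbb{Z})^q$ for some $q\geq 0$; or (euc4) $NS_2^{\,\ell}\times\mathbb{Z}^p$ for some $\ell\geq 1$, $p\geq 0$.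
   Context: For a finitely generated group $K$, $\mathrm{rk}(K)$ denotes the minimal number of generators of $K$. (All subgroups of the groups $G$ considered here are finitely generated.) A subgroup $H\leq G$ is compressed in $G$ if $\mathrm{rk}(H)\leq\mathrm{rk}(K)$ for every finitely generated subgroup $K$ with $H\leq K\leq G$. For $\phi\in\mathrm{End}(G)$, $\mathrm{Fix}\,\phi=\{g\in G\mid\phi(g)=g\}$. *)

(* Defs.v *)
From HB Require Import structures.
From mathcomp Require Import all_boot all_algebra.
From mathcomp Require Import boolp classical_sets.

Set Implicit Arguments.
Unset Strict Implicit.
Unset Printing Implicit Defensive.

Local Open Scope classical_set_scope.
Local Open Scope quotient_scope.
Local Open Scope group_scope.

(* Possibly infinite groups are MathComp's [groupType]; between groups, maps
   preserving products ([{multiplicative G -> H}]) are the homomorphisms. *)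

Definition isog (G H : groupType) : Prop :=
  exists f : {multiplicative G -> H}, bijective f.

Section FiniteRank.
Variable G : groupType.
Implicit Types (s : seq G) (H K : set G).

Definition generated s : set G :=
  smallest (fun K => group_closed (mem K)) [set` s].

(* As [generated s] is a subgroup, this says that [K] is a finitely generated
   subgroup. *)
Definition fg_subgroup K : Prop := exists s, generated s = K.

Definition generated_by_n K (n : nat) : bool :=
  `[< exists2 s, size s = n & generated s = K >].

(* The value 0 is a dummy if [K] is not a finitely generated subgroup. *)
Definition rk K : nat :=
  if pselect (exists n, generated_by_n K n) is left exK then ex_minn exK else 0.

(* Finite generation of [H] is required so that [rk H] is meaningful. *)
Definition compressed H : Prop :=
  fg_subgroup H /\
  forall K, fg_subgroup K -> H `<=` K -> (rk H <= rk K)%N.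

Definition Fix (phi : G -> G) : set G := [set g | phi g = g].

End FiniteRank.

(* MathComp only has this group structure for families of finite groups. *)
Section DirectProduct.
Variables (I : finType) (gT : I -> groupType).
Local Notation prodT := {dffun forall i : I, gT i}.

Definition dprod_mul (x y : prodT) : prodT := [ffun i => x i * y i].
Definition dprod_one : prodT := [ffun=> 1].
Definition dprod_inv (x : prodT) : prodT := [ffun i => (x i)^-1].

Lemma dprod_mulA : associative dprod_mul.
Proof. by move=> x y z; apply/ffunP => i; rewrite !ffunE mulgA. Qed.
Lemma dprod_mul1 : left_id dprod_one dprod_mul.
Proof. by move=> x; apply/ffunP => i; rewrite !ffunE mul1g. Qed.
Lemma dprod_mulr1 : right_id dprod_one dprod_mul.
Proof. by move=> x; apply/ffunP => i; rewrite !ffunE mulg1. Qed.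
Lemma dprod_mulV : left_inverse dprod_one dprod_inv dprod_mul.
Proof. by move=> x; apply/ffunP => i; rewrite !ffunE mulVg. Qed.
Lemma dprod_mulrV : right_inverse dprod_one dprod_inv dprod_mul.
Proof. by move=> x; apply/ffunP => i; rewrite !ffunE mulgV. Qed.

HB.instance Definition _ := isGroup.Build prodT
  dprod_mulA dprod_mul1 dprod_mulr1 dprod_mulV dprod_mulrV.

Definition dprodg : groupType := prodT.

End DirectProduct.

(* The group with presentation < X | rels >: words in the letters x = (x, false)
   and x^-1 = (x, true), modulo the congruence generated by
   x x^-1 = x^-1 x = 1 and r = 1 for r in [rels]. *)
Section Presentation.
Variable X : choiceType.
Definition word := seq (X * bool).
Variable rels : set word.

Inductive word_eq : word -> word -> Prop :=
| word_eq_refl u : word_eq u u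
| word_eq_sym u v : word_eq u v -> word_eq v u
| word_eq_trans u v w : word_eq u v -> word_eq v w -> word_eq u w
| word_eq_cat u u' v v' :
    word_eq u u' -> word_eq v v' -> word_eq (u ++ v) (u' ++ v')
| word_eq_cancel x e : word_eq [:: (x, e); (x, ~~ e)] [::]
| word_eq_rel r : rels r -> word_eq r [::].

Definition word_eqb (u v : word) : bool := `[< word_eq u v >].

Lemma word_eqb_equiv : equiv_class_of word_eqb.
Proof.
split=> [u | u v | v u w].
- exact/asboolP/word_eq_refl.
- by apply/asboolP/asboolP => /word_eq_sym.
- by move=> /asboolP uv /asboolP vw; exact/asboolP/(word_eq_trans uv vw).
Qed.

Canonical word_eqb_equivRel := EquivRelPack word_eqb_equiv.

Definition presented := {eq_quot word_eqb}.
HB.instance Definition _ := Choice.on presented.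

Definition word_inv (u : word) : word := rev [seq (l.1, ~~ l.2) | l <- u].

Definition pres_class (u : word) : presented := \pi_presented u.
Definition pres_mul (x y : presented) := pres_class (repr x ++ repr y).
Definition pres_one := pres_class [::].
Definition pres_inv (x : presented) := pres_class (word_inv (repr x)).

Lemma pres_classP u v : reflect (word_eq u v) (pres_class u == pres_class v).
Proof. by rewrite /pres_class eqmodE; exact: asboolP. Qed.

Lemma word_eq_repr u : word_eq (repr (pres_class u)) u.
Proof. by apply/pres_classP; rewrite /pres_class reprK. Qed.

Lemma pres_class_repr x : pres_class (repr x) = x.
Proof. exact: reprK. Qed.

Lemma pres_classM u v : pres_mul (pres_class u) (pres_class v) =
  pres_class (u ++ v).
Proof. by apply/eqP/pres_classP/word_eq_cat; exact: word_eq_repr. Qed.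

Lemma word_mulV u : word_eq (u ++ word_inv u) [::].
Proof.
elim: u => [|[x e] u IHu]; first exact: word_eq_refl.
have -> : ((x, e) :: u) ++ word_inv ((x, e) :: u) =
    [:: (x, e)] ++ (u ++ word_inv u) ++ [:: (x, ~~ e)].
  by rewrite /word_inv /= rev_cons -cats1 !catA.
apply: (@word_eq_trans _ [:: (x, e); (x, ~~ e)]); last exact: word_eq_cancel.
rewrite -[[:: (x, e); _]]/([:: (x, e)] ++ [::] ++ [:: (x, ~~ e)]).
apply: word_eq_cat; first exact: word_eq_refl.
by apply: word_eq_cat IHu _; exact: word_eq_refl.
Qed.

Lemma word_invK : involutive word_inv.
Proof.
move=> u; rewrite /word_inv map_rev revK -map_comp -[RHS]map_id.
by apply: eq_map => -[x e] /=; rewrite negbK.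
Qed.

Lemma word_mulVl u : word_eq (word_inv u ++ u) [::].
Proof. by rewrite -{2}(word_invK u); exact: word_mulV. Qed.

Lemma pres_mulA : associative pres_mul.
Proof.
move=> x y z; rewrite -(pres_class_repr x) -(pres_class_repr y).
by rewrite -(pres_class_repr z) !pres_classM catA.
Qed.
Lemma pres_mul1 : left_id pres_one pres_mul.
Proof. by move=> x; rewrite -(pres_class_repr x) pres_classM. Qed.
Lemma pres_mulr1 : right_id pres_one pres_mul.
Proof. by move=> x; rewrite -(pres_class_repr x) pres_classM cats0. Qed.
Lemma pres_mulV : left_inverse pres_one pres_inv pres_mul.
Proof.
move=> x; rewrite -{2}(pres_class_repr x) pres_classM.
exact/eqP/pres_classP/word_mulVl.
Qed.
Lemma pres_mulrV : right_inverse pres_one pres_inv pres_mul.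
Proof.
move=> x; rewrite -{1}(pres_class_repr x) pres_classM.
exact/eqP/pres_classP/word_mulV.
Qed.

HB.instance Definition _ := isGroup.Build presented
  pres_mulA pres_mul1 pres_mulr1 pres_mulV pres_mulrV.

End Presentation.

(* < a, b | b a b^-1 a > with a = 0 and b = 1 in 'I_2. *)
Definition NS2 : groupType :=
  let a : 'I_2 := ord0 in let b : 'I_2 := ord_max in
  presented [set [:: (b, false); (a, false); (b, true); (a, false)]].

Definition trivg : groupType := Algebra.to_multiplicative 'I_1.
Definition Zgrp : groupType := Algebra.to_multiplicative int.
Definition C2 : groupType := Algebra.to_multiplicative 'Z_2.

Definition gpow (G : groupType) (n : nat) : groupType := {ffun 'I_n -> G}.

Definition euclidean_surface_group (G : groupType) : Prop :=
  [\/ isog G trivg, isog G Zgrp, isog G (Zgrp * Zgrp)%type | isog G C2 ]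
  \/ isog G NS2.

(* Main.v *)
Require Import Defs.
From HB Require Import structures.
From mathcomp Require Import all_boot all_order all_algebra zify ring.
From mathcomp Require Import boolp classical_sets.

(* Every product of these groups is Klein^l x Z^p x C2^q, where the Klein bottle
   group is Z x| Z, with elements a^i b^j.

   In the torsion-free case let A = <a_1, ..., a_l> = Z^l, with abelian quotient
   Z^(l+p). Elements of A are those inverted by some conjugation, so A is
   preserved by every endomorphism phi, and H = Fix phi meets A in a pure
   subgroup. If K contains H, the image of K in Z^(l+p) has some rank r, and H
   needs at most k + r generators, where k is the rank of A n H. By purity A n H
   still has dimension k mod 2 A, which is detected by homomorphisms G -> F_2;
   hence K maps onto F_2^(k + r) and needs at least k + r generators.

   In Klein x C2^q, Nielsen reduction along the b-exponent shows that every
   subgroup is compressed, and in the abelian case this is classical.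

   In all the other cases G = Klein x C2 x X with X mapping onto Z, and there is
   an explicit automorphism whose fixed subgroup is not compressed. *)

Set Implicit Arguments.
Unset Strict Implicit.
Unset Printing Implicit Defensive.
Import Order.TTheory GRing.Theory Num.Theory.
Local Open Scope classical_set_scope.
Local Open Scope group_scope.

(** * Generated subgroups and rank *)

Definition subgroup (G : groupType) (H : set G) : Prop :=
  [/\ H 1, forall x y, H x -> H y -> H (x * y) & forall x, H x -> H x^-1].

Section Generated.
Variable G : groupType.
Implicit Types (s t : seq G) (H K N : set G) (x y : G).

Lemma group_closed_subgroup H : group_closed (mem H) <-> subgroup H.
Proof.
split=> [HG | [H1 HM HV]].
  split; first by have := HG.1; rewrite inE.
    move=> x y Hx Hy; have := group_closedM HG (x := x) (y := y).
    by rewrite !inE; apply.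
  by move=> x Hx; have := group_closedV HG (x := x); rewrite !inE; apply.
split; first by rewrite inE.
by move=> x y; rewrite !inE => Hx Hy; apply: HM => //; apply: HV.
Qed.

Lemma subgroup_generated s : subgroup (generated s).
Proof.
split=> [K [/group_closed_subgroup[]] // | x y Hx Hy K KP | x Hx K KP].
  by have /group_closed_subgroup[_ KM _] := KP.1; apply: KM; [exact: Hx | exact: Hy].
by have /group_closed_subgroup[_ _] := KP.1; apply; exact: Hx.
Qed.

Lemma mem_generated s x : x \in s -> generated s x.
Proof. by move=> xs K [_]; apply. Qed.

Lemma generated_min s H :
  subgroup H -> (forall x, x \in s -> H x) -> generated s `<=` H.
Proof.
by move=> HG Hs x; apply; split; [apply/group_closed_subgroup | exact: Hs].
Qed.

Lemma generated1 s : generated s 1.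
Proof. by case: (subgroup_generated s). Qed.

Lemma generatedM s x y :
  generated s x -> generated s y -> generated s (x * y).
Proof. by case: (subgroup_generated s) => _ + _; apply. Qed.

Lemma generatedV s x : generated s x -> generated s x^-1.
Proof. by case: (subgroup_generated s) => _ _; apply. Qed.

Lemma generated_sub s t :
  (forall x, x \in s -> generated t x) -> generated s `<=` generated t.
Proof. by apply: generated_min; exact: subgroup_generated. Qed.

Lemma generatedS s t : {subset s <= t} -> generated s `<=` generated t.
Proof. by move=> st; apply: generated_sub => x /st; exact: mem_generated. Qed.

Lemma generated_ind s (P : G -> Prop) : P 1 ->
  (forall x y, generated s x -> generated s y -> P x -> P y -> P (x * y)) ->
  (forall x, generated s x -> P x -> P x^-1) ->
  (forall x, x \in s -> P x) -> forall x, generated s x -> P x.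
Proof.
move=> P1 PM PV Ps x sx; suff [] : (generated s `&` P) x by [].
move: x sx; apply: (@generated_min s (generated s `&` P)).
  split; first by split=> //; exact: generated1.
  - by move=> x y [sx Px] [sy Py]; split; [exact: generatedM | exact: PM].
  - by move=> x [sx Px]; split; [exact: generatedV | exact: PV].
by move=> x xs; split; [exact: mem_generated | exact: Ps].
Qed.

Lemma subgroupI H K : subgroup H -> subgroup K -> subgroup (H `&` K).
Proof.
move=> [H1 HM HV] [K1 KM KV]; split=> //.
- by move=> x y [? ?] [? ?]; split; [exact: HM | exact: KM].
- by move=> x [? ?]; split; [exact: HV | exact: KV].
Qed.

Lemma subgroupT : subgroup [set: G]. Proof. by split. Qed.

End Generated.

Section Morphisms.
Variables (G Q : groupType) (f : G -> Q).
Hypothesis fM : {morph f : x y / x * y}.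

Lemma morph_1 : f 1 = 1.
Proof. by apply: (mulgI (f 1)); rewrite -fM !mulg1. Qed.

Lemma morph_V x : f x^-1 = (f x)^-1.
Proof. by apply: (mulgI (f x)); rewrite -fM !mulgV morph_1. Qed.

Lemma subgroup_preim (K : set Q) : subgroup K -> subgroup (f @^-1` K).
Proof.
case=> K1 KM KV; split; rewrite /preimage /=; first by rewrite morph_1.
- by move=> x y; rewrite fM; exact: KM.
- by move=> x; rewrite morph_V; exact: KV.
Qed.

Lemma subgroup_im (H : set G) : subgroup H -> subgroup (f @` H).
Proof.
case=> H1 HM HV; split; first by exists 1 => //; exact: morph_1.
- by move=> _ _ [x Hx <-] [y Hy <-]; exists (x * y); [exact: HM | exact: fM].
- by move=> _ [x Hx <-]; exists x^-1; [exact: HV | exact: morph_V].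
Qed.

Lemma generated_map s : generated (map f s) = f @` generated s.
Proof.
apply/seteqP; split.
  apply: generated_min; first exact/subgroup_im/subgroup_generated.
  by move=> _ /mapP[x xs ->]; exists x => //; exact: mem_generated.
suff: generated s `<=` f @^-1` generated (map f s) by move=> fs _ [x /fs sx <-].
apply: generated_min; first exact/subgroup_preim/subgroup_generated.
by move=> x xs; apply: mem_generated; apply: map_f.
Qed.

End Morphisms.

(** Finite generation and an upper bound for the rank in one statement, so that the default value of
    [rk] never enters. *)
Definition gen_le (G : groupType) (H : set G) (n : nat) : Prop :=
  exists2 s, (size s <= n)%N & generated s = H.

Section Rank.
Variable G : groupType.
Implicit Types (s t : seq G) (H K N : set G) (x y : G).

Lemma rk_le s : (rk (generated s) <= size s)%N.
Proof.
rewrite /rk; case: pselect => // exK.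
by case: ex_minnP => m _ mP; apply: mP; apply/asboolP; exists s.
Qed.

Lemma rk_gen K : fg_subgroup K -> exists2 s, size s = rk K & generated s = K.
Proof.
move=> [s sK]; rewrite /rk; case: pselect => [exK | []].
  by case: ex_minnP => m /asboolP[t tm tK] _; exists t.
by exists (size s); apply/asboolP; exists s.
Qed.

(** A finitely generated subgroup has a generating sequence of length its rank, so compression only
    compares lengths of sequences. Finite generation of [H] comes from the right-hand side applied
    to generators of [G]. *)
Lemma compressedP H : (exists t, generated t = [set: G]) ->
  compressed H <-> forall t, H `<=` generated t -> gen_le H (size t).
Proof.
move=> [t0 t0G]; split=> [[Hfg Hrk] t Ht | Hle].
  have [s sH <-] := rk_gen Hfg; exists s => //; rewrite sH.
  by apply: leq_trans (rk_le t); apply: Hrk => //; exists t.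
split=> [|K /rk_gen[t <- <-] Ht].
  by have [|s _ sH] := Hle t0; [rewrite t0G | exists s].
by have [s st <-] := Hle _ Ht; exact: leq_trans (rk_le s) st.
Qed.

Definition expz x (z : int) : G :=
  match z with Posz n => x ^+ n | Negz n => x ^- n.+1 end.

Lemma expzD x : {morph expz x : i j / (i + j)%R >-> i * j}.
Proof.
have S i : expz x (i + 1)%R = expz x i * x.
  case: i => [n | [|n]].
  - by rewrite (_ : n%:Z + 1 = n.+1)%R; [rewrite /= expgSr | lia].
  - by rewrite /= mulVg.
  - rewrite (_ : Negz n.+1 + 1 = Negz n)%R; last by rewrite !NegzE; lia.
    by rewrite /= (expgS x n.+1) invgM mulgVK.
have P i : expz x (i - 1)%R = expz x i * x^-1.
  by apply: (mulIg x); rewrite -S subrK mulgVK.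
move=> i; elim/int_ind => [|n IH|n IH]; first by rewrite addr0 mulg1.
  by rewrite -addn1 PoszD addrA !S IH mulgA.
by rewrite (_ : - n.+1%:Z = - n%:Z - 1)%R ?addrA ?P ?IH ?mulgA //; lia.
Qed.

End Rank.

(** * Upper bounds for the number of generators *)

(** Division by the least positive element leaves remainders in [J], which must vanish; if no
    element is positive, [d = 0]. *)
Lemma subgroup_int (J : set Zgrp) : subgroup J ->
  exists d : int, J d /\ forall i : int, J i -> exists m : int, i = (m * d)%R.
Proof.
case=> J0 JM JV.
have JD (i j : int) : J i -> J j -> J (i + j)%R := JM i j.
have JN (i : int) : J i -> J (- i)%R := JV i.
have [[n n0 Jn] | noJ] :=
    pselect (exists2 n : nat, (0 < n)%N & J (Posz n)); last first.
  exists 0%R; split=> // i Ji; exists 0%R; rewrite mul0r.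
  case: (ltrgtP i 0%R) => // i0; case: noJ; exists `|i|%N; try lia.
    by rewrite (_ : Posz `|i|%N = - i)%R; [exact: JN | lia].
  by rewrite (_ : Posz `|i|%N = i)%R; last lia.
have exJ : exists n, (0 < n)%N && `[< J (Posz n) >].
  by exists n; rewrite n0; apply/asboolP.
case: (ex_minnP exJ) => d /andP[d0 /asboolP Jd] dmin.
exists (Posz d); split=> // i Ji; exists (i %/ d)%Z.
have JX (m : int) : J (m * d)%R.
  elim/int_ind: m => [|m IH|m IH]; first by rewrite mul0r.
    by rewrite intS mulrDl mul1r; exact: JD.
  by rewrite intS opprD mulrDl mulN1r; apply: JD => //; exact: JN.
have Jr : J (i %% d)%Z.
  rewrite (_ : (i %% d)%Z = i + - ((i %/ d)%Z * d))%R; last first.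
    by rewrite {2}(divz_eq i d) addrC addKr.
  by apply: JD => //; apply: JN.
have r0 : (0 <= i %% d)%Z%R by apply: modz_ge0; lia.
have rd : ((i %% d)%Z < Posz d)%R by rewrite ltz_mod; lia.
rewrite [LHS](divz_eq i d); suff -> : (i %% d)%Z = 0%R by rewrite addr0.
apply/eqP; apply: contraT => rn0.
have := dmin `|(i %% d)%Z|%N; rewrite (_ : Posz `|(i %% d)%Z|%N = (i %% d)%Z); last lia.
by rewrite asboolT // andbT; lia.
Qed.

Section IntegerPowers.
Variable G : groupType.
Implicit Types (s t : seq G) (H K N : set G) (x y : G).

Lemma expzN x i : expz x (- i) = (expz x i)^-1.
Proof. by apply: (mulgI (expz x i)); rewrite -expzD subrr mulgV. Qed.

Lemma expzS x (n : nat) : expz x (Posz n.+1) = x * expz x (Posz n).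
Proof. exact: expgS. Qed.

Lemma expzNS x (n : nat) : expz x (- Posz n.+1) = x^-1 * expz x (- Posz n).
Proof. by rewrite intS opprD expzD. Qed.

Lemma subgroup_expz H x i : subgroup H -> H x -> H (expz x i).
Proof.
move=> [H1 HM HV] Hx; elim/int_ind: i => [|i IH|i IH] //.
- by rewrite expzS; exact: HM.
- by rewrite expzNS; apply: HM => //; exact: HV.
Qed.

Section CyclicExtension.
Variables (x : G) (N : set G).
Hypothesis NG : subgroup N.
Hypothesis Nx : forall w, N w -> N (x * w * x^-1).
Hypothesis NVx : forall w, N w -> N (x^-1 * w * x).

(** The coset x^i N. Different [i] may give the same coset, so this is a relation between exponents
    and elements, not a function of the element. *)
Definition power_coset i : set G := [set g | exists2 w, N w & g = expz x i * w].

Lemma normal_expz j w : N w -> N (expz x j * w * (expz x j)^-1).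
Proof.
have JM y z v : y * z * v * (y * z)^-1 = y * (z * v * z^-1) * y^-1.
  by rewrite invgM !mulgA.
elim/int_ind: j => [|j IH|j IH] Nw; first by rewrite mul1g invg1 mulg1.
  by rewrite expzS JM; apply/Nx/IH.
by rewrite expzNS JM invgK; apply/NVx/IH.
Qed.

Lemma power_cosetM i j g h :
  power_coset i g -> power_coset j h -> power_coset (i + j)%R (g * h).
Proof.
case: NG => _ NM _ [w Nw ->] [v Nv ->].
exists ((expz x j)^-1 * w * expz x j * v); last by rewrite expzD !mulgA mulgK.
apply: NM => //; have := normal_expz (- j)%R Nw; rewrite expzN; congr N.
by rewrite invgK.
Qed.

Lemma power_cosetV i g : power_coset i g -> power_coset (- i)%R g^-1.
Proof.
case: NG => _ _ NV [w Nw ->]; exists (expz x i * w^-1 * (expz x i)^-1).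
  by apply/normal_expz/NV.
by rewrite expzN invgM !mulgA mulVg mul1g.
Qed.

Lemma power_coset1 : power_coset 0%R 1.
Proof. by case: NG => ? _ _; exists 1 => //; rewrite mulg1. Qed.

Lemma subgroup_power_cosets : subgroup [set g | exists i, power_coset i g].
Proof.
split; first by exists 0%R; exact: power_coset1.
- by move=> g h [i Pg] [j Ph]; exists (i + j)%R; exact: power_cosetM.
- by move=> g [i Pg]; exists (- i)%R; exact: power_cosetV.
Qed.

(** The exponents [i] for which [H] meets x^i N form a subgroup d Z. An element of [H] in x^d N,
    together with generators of the intersection of [H] with [N], generates [H]. *)
Lemma gen_le_cyclic_extension H n : subgroup H ->
  (forall h, H h -> exists i, power_coset i h) ->
  gen_le (H `&` N) n -> gen_le H n.+1.
Proof.
move=> HG Hcos [s sn sHN]; have [H1 HM HV] := HG.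
have [] := @subgroup_int [set i | exists2 g, H g & power_coset i g].
  split.
  - by exists 1 => //; exact: power_coset1.
  - move=> i j [g Hg Pg] [h Hh Ph].
    by exists (g * h); [exact: HM | exact: power_cosetM].
  - by move=> i [g Hg Pg]; exists g^-1; [exact: HV | exact: power_cosetV].
move=> d [[h Hh Ph] dgen].
have PX m : power_coset (m * d)%R (expz h m).
  elim/int_ind: m => [|m IH|m IH].
  - by rewrite mul0r; exact: power_coset1.
  - by rewrite expzS intS mulrDl mul1r; apply: power_cosetM.
  - rewrite expzNS intS opprD mulrDl mulN1r.
    by apply: power_cosetM => //; exact: power_cosetV.
exists (h :: s) => //; apply/seteqP; split.
  apply: generated_min => // y; rewrite inE => /orP[/eqP -> //|ys].
  by have /(mem_generated (s := s)) := ys; rewrite sHN => -[].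
move=> g Hg; have [i Pg] := Hcos g Hg.
have [|m im] := dgen i; first by exists g.
have : (H `&` N) (expz h (- m) * g).
  split; first by apply: HM => //; exact: subgroup_expz.
  have := power_cosetM (PX (- m)%R) Pg; rewrite im mulNr addNr => -[w Nw ->].
  by rewrite mul1g.
rewrite -sHN => sg.
rewrite (_ : g = expz h m * (expz h (- m) * g)); last first.
  by rewrite mulgA -expzD subrr mul1g.
apply: generatedM; last first.
  by apply: generatedS sg => y ys; rewrite inE ys orbT.
apply: (subgroup_expz _ (subgroup_generated _)).
by apply: mem_generated; rewrite mem_head.
Qed.

End CyclicExtension.

End IntegerPowers.

Lemma generated_nil (G : groupType) : generated (@nil G) = [set 1].
Proof.
apply/seteqP; split=> [|_ ->]; last exact: generated1.
apply: generated_min => //; split=> //.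
- by move=> _ _ -> ->; rewrite /= mulg1.
- by move=> _ ->; rewrite /= invg1.
Qed.

Section NumberOfGenerators.
Variable G : groupType.
Implicit Types (s t : seq G) (H K N : set G) (x y : G).

Lemma gen_le_leq H m n : (m <= n)%N -> gen_le H m -> gen_le H n.
Proof. by move=> mn [s sm sH]; exists s => //; exact: leq_trans mn. Qed.

(** As [x] normalises N = [generated s], the group [generated (x :: s)] is a union of cosets x^i
    N. *)
Lemma gen_le_cons x s H n :
  (forall w, generated s w -> generated s (x * w * x^-1)) ->
  (forall w, generated s w -> generated s (x^-1 * w * x)) ->
  subgroup H -> H `<=` generated (x :: s) ->
  gen_le (H `&` generated s) n -> gen_le H n.+1.
Proof.
move=> sJ sVJ HG Hs; have sG := subgroup_generated s.
apply: (gen_le_cyclic_extension sG sJ sVJ) => // h /Hs; move: h.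
apply: generated_min; first exact: subgroup_power_cosets.
move=> y; rewrite inE => /orP[/eqP ->|ys].
  by exists 1%R; exists 1; [exact: generated1 | rewrite /= mulg1].
by exists 0%R; exists y; [exact: mem_generated | rewrite mul1g].
Qed.

(** Induction on [t]: by commutativity the head normalises the subgroup generated by the tail, and
    each cyclic extension costs one generator. *)
Lemma gen_le_abelian t H :
  (forall x y, generated t x -> generated t y -> x * y = y * x) ->
  subgroup H -> H `<=` generated t -> gen_le H (size t).
Proof.
elim: t H => [|x t IH] H tC HG Ht.
  exists [::] => //; rewrite generated_nil; apply/seteqP; split.
    by move=> _ ->; case: HG.
  by rewrite -generated_nil.
have tS : generated t `<=` generated (x :: t).
  by apply: generatedS => y yt; rewrite inE yt orbT.
have xt : generated (x :: t) x by apply: mem_generated; rewrite mem_head.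
apply: (@gen_le_cons x t) => //.
- by move=> w tw; rewrite (tC x) ?mulgK //; exact: tS.
- by move=> w tw; rewrite -mulgA -(tC x) ?mulKg //; exact: tS.
- apply: IH; first by move=> y z ? ?; apply: tC; exact: tS.
    by apply: subgroupI => //; exact: subgroup_generated.
  by move=> y [].
Qed.

(** Lifts to [H] of generators of the image, together with generators of the kernel in [H], generate
    [H]. *)
Lemma gen_le_hom (Q : groupType) (f : G -> Q) H m n :
  {morph f : x y / x * y} -> subgroup H ->
  gen_le (f @` H) m -> gen_le (H `&` f @^-1` [set 1]) n -> gen_le H (m + n).
Proof.
move=> fM HG [u um uH] [s sn sH]; have [H1 HM HV] := HG.
have [v [vH vu]] : exists v : seq G, (forall x, x \in v -> H x) /\ map f v = u.
  have : forall z : Q, z \in u -> (f @` H) z by rewrite -uH; exact: mem_generated.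
  elim: (u) => [|y r IH] yH; first by exists [::].
  have [x Hx xy] := yH y (mem_head _ _).
  have [|v [vH vr]] := IH; first by move=> z zr; apply: yH; rewrite inE zr orbT.
  exists (x :: v); split; last by rewrite /= xy vr.
  by move=> z; rewrite inE => /orP[/eqP -> // | /vH].
exists (v ++ s); first by rewrite size_cat leq_add // -(size_map f) vu.
apply/seteqP; split.
  apply: generated_min => // x; rewrite mem_cat => /orP[/vH // |].
  by move=> /(mem_generated (s := s)); rewrite sH => -[].
move=> g Hg; have : (f @` H) (f g) by exists g.
rewrite -uH -vu generated_map // => -[w vw wg].
have vsw : generated (v ++ s) w.
  by apply: generatedS vw => y yv; rewrite mem_cat yv.
rewrite (_ : g = w * (w^-1 * g)); last by rewrite mulVKg.
apply: generatedM => //; apply: (@generatedS _ s).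
  by move=> y ys; rewrite mem_cat ys orbT.
rewrite sH; split; last by rewrite /preimage /= fM morph_V // wg mulVg.
by apply: HM => //; apply: HV; move: w vw {wg vsw}; exact: generated_min.
Qed.

(** Euclid's algorithm on the values of [f] changes the generators but not their number, until all
    but one lie in the kernel. The unit of [Zgrp] is the integer 0. *)
Lemma nielsen_reduction (f : G -> Zgrp) x t : {morph f : x y / x * y} ->
  exists y u, [/\ size u = size t, generated (y :: u) = generated (x :: t) &
    forall z, z \in u -> f z = 1].
Proof.
move=> fM.
(* The case of two generators, by induction on |f z|: the pair (x1, z) becomes (z, x1 z^-q), where q
   is the quotient of f x1 by f z. *)
have two x1 z : exists y1 z1, [/\ f z1 = 1,
    generated [:: x1; z] y1, generated [:: x1; z] z1,
    generated [:: y1; z1] x1 & generated [:: y1; z1] z].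
  have [n] := ubnP (`|f z : int|%N); elim: n x1 z => // n IH x1 z fz.
  have x1z y z' : generated [:: y; z'] y /\ generated [:: y; z'] z'.
    by split; apply: mem_generated; rewrite !inE eqxx ?orbT.
  have [fz0 | fz0] := eqVneq (f z : int) 0%R.
    by exists x1, z; split=> //; apply x1z.
  pose q : int := ((f x1 : int) %/ (f z : int))%Z.
  have fX (j : int) : f (expz z j) = (j * (f z : int))%R.
    elim/int_ind: j => [|j IHj|j IHj].
    - by rewrite mul0r; exact: morph_1.
    - by rewrite expzS fM IHj intS mulrDl mul1r.
    - by rewrite expzNS fM IHj (morph_V fM z) intS opprD mulrDl mulN1r.
  have fr : f (x1 * expz z (- q)) = ((f x1 : int) %% (f z : int))%Z.
    rewrite fM fX; change ((f x1 : int) + - q * (f z : int) = modz (f x1) (f z))%R.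
    by have := divz_eq (f x1) (f z); rewrite -/q; lia.
  have [|y1 [z1 [fz1 yz zz yr zr]]] := IH z (x1 * expz z (- q)).
    rewrite fr; have := @ltz_mod (f x1) (f z) fz0; have := @modz_ge0 (f x1) (f z) fz0.
    by lia.
  have sub : generated [:: z; x1 * expz z (- q)] `<=` generated [:: x1; z].
    have [xx xz] := x1z x1 z.
    apply: generated_sub => w; rewrite !inE => /orP[/eqP -> // | /eqP ->].
    by apply: generatedM => //; apply: (subgroup_expz _ (subgroup_generated _)).
  exists y1, z1; split=> //; try exact: sub.
  rewrite (_ : x1 = x1 * expz z (- q) * expz z q); last first.
    by rewrite -mulgA -expzD addNr mulg1.
  by apply: generatedM => //; apply: (subgroup_expz _ (subgroup_generated _)).
elim: t x => [|z t IH] x; first by exists x, [::].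
(* Once [x :: t] is reduced, only [y] may have a nonzero value; the pair [y], [z] is reduced
   next. *)
have [y [u [ut gyu fu]]] := IH x.
have [y1 [z1 [fz1 yz zz yr zr]]] := two y z.
exists y1, (z1 :: u); split; first by rewrite /= ut.
  have cons2 (a b : G) (r : seq G) : generated [:: a; b] `<=` generated [:: a, b & r].
    by apply: generatedS => w; rewrite !inE => /orP[] ->; rewrite ?orbT.
  have consu (a b : G) (w : G) : w \in u -> generated [:: a, b & u] w.
    by move=> wu; apply: mem_generated; rewrite !inE wu !orbT.
  have -> : generated [:: x, z & t] = generated [:: y, z & u].
    have swap (a b : G) (r : seq G) : generated (a :: r) `<=` generated [:: a, b & r].
      by apply: generatedS => w; rewrite !inE => /orP[] ->; rewrite ?orbT.
    have skip (a b : G) (r : seq G) : generated [:: a, b & r] b.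
      by apply: mem_generated; rewrite !inE eqxx orbT.
    apply/seteqP; split; apply: generated_sub => w; rewrite inE.
      move=> /orP[/eqP ->|].
        by apply: swap; rewrite gyu; apply: mem_generated; rewrite mem_head.
      rewrite inE => /orP[/eqP -> // | wt].
      by apply: swap; rewrite gyu; apply: mem_generated; rewrite inE wt orbT.
    move=> /orP[/eqP ->|].
      by apply: swap; rewrite -gyu; apply: mem_generated; rewrite mem_head.
    rewrite inE => /orP[/eqP -> // | wt].
    by apply: swap; rewrite -gyu; apply: mem_generated; rewrite inE wt orbT.
  apply/seteqP; split; apply: generated_sub => w; rewrite !inE.
    by move=> /or3P[/eqP -> | /eqP -> | /consu //]; exact: cons2.
  by move=> /or3P[/eqP -> | /eqP -> | /consu //]; exact: cons2.
by move=> w; rewrite inE => /orP[/eqP -> // | /fu].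
Qed.

(* As every cyclic subgroup of the kernel is normal, the generators produced by
   [nielsen_reduction] exhibit any finitely generated subgroup as a cyclic
   extension of an abelian group with one generator less. *)
Lemma gen_le_hom_int (f : G -> Zgrp) t H : {morph f : x y / x * y} ->
  (forall x y, f x = 1 -> f y = 1 -> x * y = y * x) ->
  (forall g x, f x = 1 -> g * x * g^-1 = x \/ g * x * g^-1 = x^-1) ->
  subgroup H -> H `<=` generated t -> gen_le H (size t).
Proof.
move=> fM kerC kerJ HG; case: t => [|x t].
  by apply: gen_le_abelian => // x y; rewrite generated_nil => -> ->.
rewrite [size _]/=; have [y [u [/= <- <- fu]]] := nielsen_reduction x t fM.
have ker_u : generated u `<=` f @^-1` [set 1].
  apply: generated_min => //; apply: subgroup_preim => //.
  by rewrite -(generated_nil Zgrp); exact: subgroup_generated.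
have uJ g w : generated u w -> generated u (g * w * g^-1).
  by move=> uw; case: (kerJ g w (ker_u w uw)) => -> //; exact: generatedV.
move=> Hu; apply: (@gen_le_cons y u) => //; first exact: uJ.
  by move=> w uw; rewrite -[X in _ * X](invgK y); exact: uJ.
apply: gen_le_abelian; first by move=> a b /ker_u fa /ker_u; exact: kerC.
  by apply: subgroupI => //; exact: subgroup_generated.
by move=> z [].
Qed.

End NumberOfGenerators.

(** * Lower bounds from homomorphisms to F_2 *)

Section AdditiveOn.
Variables (G : groupType) (H : set G) (V : zmodType) (a : G -> V).
Hypothesis HG : subgroup H.
Hypothesis aD : forall x y, H x -> H y -> a (x * y) = (a x + a y)%R.

Lemma additive_on1 : a 1 = 0%R.
Proof. by case: HG => H1 _ _; apply: (addrI (a 1)); rewrite -aD // mulg1 addr0. Qed.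

Lemma additive_onV x : H x -> a x^-1 = (- a x)%R.
Proof.
case: HG => _ _ HV Hx; apply: (addrI (a x)).
by rewrite -aD ?mulgV ?additive_on1 ?subrr //; exact: HV.
Qed.

Lemma subgroup_prod (I : Type) (r : seq I) (y : I -> G) :
  (forall i, H (y i)) -> H (\prod_(i <- r) y i).
Proof. by case: HG => H1 HM _ Hy; elim/big_ind: _. Qed.

Lemma additive_on_prod (I : Type) (r : seq I) (y : I -> G) :
  (forall i, H (y i)) -> a (\prod_(i <- r) y i) = (\sum_(i <- r) a (y i))%R.
Proof.
move=> Hy; elim: r => [|i r IH]; first by rewrite !big_nil additive_on1.
by rewrite !big_cons aD ?IH //; exact: subgroup_prod.
Qed.

End AdditiveOn.

(** The [chi i] together map [generated s] to F_2^I. The image is spanned by the images of the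
    elements of [s] and contains the standard basis, so its dimension bounds the size of [s] from
    below. Additivity is asked on [generated s] because some maps used below are additive only on a
    subgroup. *)
Lemma dual_size (G : groupType) (I : finType) (s : seq G)
    (chi : I -> G -> 'F_2) (y : I -> G) :
  (forall i x z, generated s x -> generated s z ->
     chi i (x * z) = (chi i x + chi i z)%R) ->
  (forall i, generated s (y i)) ->
  (forall i j, chi i (y j) = (i == j)%:R%R) -> (#|I| <= size s)%N.
Proof.
move=> chiD sy chiy; have sG := subgroup_generated s.
pose F x : 'rV['F_2]_#|I| := (\row_k chi (enum_val k) x)%R.
have FD x z : generated s x -> generated s z -> F (x * z) = (F x + F z)%R.
  by move=> sx sz; apply/rowP => k; rewrite !mxE chiD.
have Fs x : generated s x -> F x \in <<map F s>>%VS.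
  move: x; apply: (@generated_ind _ s (fun x => F x \in _))
    => [|x z sx sz Fx Fz|x sx Fx|x xs].
  - by rewrite (additive_on1 sG FD) mem0v.
  - by rewrite FD // memvD.
  - by rewrite (additive_onV sG FD) // memvN.
  - exact/memv_span/map_f.
suff : (fullv <= <<map F s>>)%VS.
  move=> /dimvS; rewrite dimvf /dim /= mul1n => /leq_trans; apply.
  by apply: leq_trans (dim_span _) _; rewrite size_map.
apply/subvP => v _; rewrite (row_sum_delta v); apply: memv_suml => k _.
apply: memvZ; have <- : F (y (enum_val k)) = ('e_k)%R; last exact: Fs.
by apply/rowP => j; rewrite !mxE eqxx chiy (inj_eq enum_val_inj).
Qed.

Lemma odd_F2 (z : int) : (z%:~R = 0 :> 'F_2)%R -> exists w, z = (w * 2)%R.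
Proof.
move=> z0; exists (z %/ 2)%Z; rewrite divzK //.
by rewrite (dvdz_pcharf (pchar_Fp (isT : prime 2))) z0.
Qed.

Lemma gpowZC N (x y : gpow Zgrp N) : x * y = y * x.
Proof. by apply/ffunP => i; rewrite !ffunE; exact: addrC. Qed.

(* For [B] free abelian: the [eta i] form the basis of Hom(B, F_2) dual to a
   basis of [B]. *)
Definition mod2_basis (G : groupType) (B : set G) (I : finType) (s : I -> G)
    (eta : I -> G -> 'F_2) : Prop :=
  [/\ generated [seq s i | i <- enum I] = B,
      forall i x y, B x -> B y -> eta i (x * y) = (eta i x + eta i y)%R
    & forall i j, eta i (s j) = (i == j)%:R%R].

(** Subgroups of Z^N are free, by induction on the number [m] of coordinates that may be nonzero.
    The last of these maps [B] onto some d Z. If d = 0 it vanishes on [B]; otherwise [B] is the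
    direct product of the kernel [B0] and the infinite cyclic group of an element [h] with that
    coordinate equal to d. *)
Lemma mod2_coordinates_below N m (B : set (gpow Zgrp N)) : subgroup B ->
  (forall x, B x -> forall i : 'I_N, (m <= i)%N -> x i = 1) ->
  exists (I : finType) s eta, @mod2_basis _ B I s eta.
Proof.
elim: m B => [|m IH] B BG Bm.
  exists void, (fun=> 1), (fun _ _ => 0%R); split; try by case.
  rewrite (_ : [seq _ | i <- _] = [::]); last by rewrite enumT unlock.
  rewrite generated_nil; apply/seteqP; split=> [_ ->|x Bx].
    by case: BG.
  by apply/ffunP => i; rewrite (Bm x) // ffunE.
have [Nm | mN] := leqP N m.
  by apply: IH => // x Bx i mi; have := ltn_ord i; rewrite ltnNge (leq_trans Nm mi).
pose k := Ordinal mN; pose f (x : gpow Zgrp N) : Zgrp := x k.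
have fM : {morph f : x y / x * y} by move=> x y; rewrite /f ffunE.
have [B1 BM BV] := BG.
have [d [[h Bh hd] dgen]] := subgroup_int (subgroup_im fM BG).
have [d0 | dn0] := eqVneq d 0%R.
  apply: IH => // x Bx i; rewrite leq_eqVlt => /orP[/eqP mi | /Bm -> //].
  have -> : i = k by apply: val_inj.
  have [|c ->] := dgen (x k); first by exists x.
  by rewrite d0 mulr0.
have fX (j : int) : f (expz h j) = (j * d)%R.
  rewrite -hd; elim/int_ind: j => [|j IHj|j IHj].
  - by rewrite mul0r; exact: morph_1.
  - by rewrite expzS fM IHj intS mulrDl mul1r.
  - by rewrite expzNS fM IHj (morph_V fM h) intS opprD mulrDl mulN1r.
(* On [B], [q] is the exponent of [h] and [r], defined below, is the projection to [B0] along
   [h]. *)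
pose q x : int := ((f x : int) %/ d)%Z.
have fq x : B x -> f x = (q x * d)%R.
  move=> Bx; have [|c cE] := dgen (f x); first by exists x.
  by rewrite /q cE mulzK.
pose r x := x * expz h (- q x).
pose B0 := B `&` f @^-1` [set 1].
have B0r x : B x -> B0 (r x).
  move=> Bx; split; first by apply: BM => //; exact: subgroup_expz.
  by rewrite /preimage /= /r fM fX mulNr fq //; exact: mulgV.
have qD x y : B x -> B y -> q (x * y) = (q x + q y)%R.
  move=> Bx By; apply: (mulIf dn0); rewrite -fq; last exact: BM.
  by rewrite fM !fq // mulrDl.
have rD x y : B x -> B y -> r (x * y) = r x * r y.
  move=> Bx By; rewrite /r qD // opprD expzD !mulgA; congr (_ * _).
  by rewrite -!mulgA; congr (_ * _); exact: gpowZC.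
have [||I [s [eta [sB etaD etas]]]] := IH B0.
- apply: subgroupI => //; apply: subgroup_preim => //.
  by rewrite -(generated_nil Zgrp); exact: subgroup_generated.
- move=> x [Bx fx] i; rewrite leq_eqVlt => /orP[/eqP mi | /(Bm x Bx) -> //].
  by have -> : i = k by apply: val_inj.
have B0s i : B0 (s i)
  by rewrite -sB; apply: mem_generated; apply: map_f; rewrite mem_enum.
have qs i : q (s i) = 0%R.
  by have [_ fs] := B0s i; rewrite /q fs div0z.
have rs i : r (s i) = s i by rewrite /r qs oppr0 mulg1.
have qh : q h = 1%R by rewrite /q hd divzz dn0.
have rh : r h = 1 by rewrite /r qh (_ : expz h (-1) = h^-1) // mulgV.
have B0G : subgroup B0 by rewrite -sB; exact: subgroup_generated.
(* [None] indexes the new basis element [h], whose dual map is the parity of [q]; the old dual maps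
   are extended through [r]. *)
exists (option I), (fun o => if o is Some i then s i else h),
  (fun o x => if o is Some i then eta i (r x) else (q x)%:~R%R); split.
- apply/seteqP; split.
    apply: generated_min => // _ /mapP[[i|] _ ->] //.
    by have [] := B0s i.
  move=> x Bx; rewrite (_ : x = r x * expz h (q x)); last first.
    by rewrite /r -mulgA -expzD addNr mulg1.
  apply: generatedM.
    have := B0r x Bx; rewrite -sB; apply: generatedS => _ /mapP[i _ ->].
    by apply/mapP; exists (Some i); rewrite ?mem_enum.
  apply: (subgroup_expz _ (subgroup_generated _)); apply: mem_generated.
  by apply/mapP; exists None; rewrite ?mem_enum.
- move=> [i|] x y Bx By; last by rewrite qD // rmorphD.
  by rewrite rD // etaD //; exact: B0r.
- move=> [i|] [j|] //=; rewrite ?rs ?etas //.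
  + by rewrite rh (additive_on1 B0G (etaD i)).
  + by rewrite qs.
  + by rewrite qh.
Qed.

Lemma mod2_coordinates N (B : set (gpow Zgrp N)) : subgroup B ->
  exists (I : finType) s eta, @mod2_basis _ B I s eta.
Proof.
move=> BG; apply: (@mod2_coordinates_below N N) => // x _ i.
by rewrite leqNgt ltn_ord.
Qed.

(** * The Klein bottle group and isomorphisms *)

(** The exponent of a in b^j a^i b^-j, as b inverts a. *)
Definition twist (j i : int) : int := if (2 %| j)%Z then i else (- i)%R.

(* The pair [(i, j)] stands for a^i b^j. *)
Definition klein := (int * int)%type.
HB.instance Definition _ := Choice.on klein.

Definition klein_mul (x y : klein) : klein :=
  (x.1 + twist x.2 y.1, x.2 + y.2)%R.
Definition klein_one : klein := (0, 0)%R.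
Definition klein_inv (x : klein) : klein := (- twist x.2 x.1, - x.2)%R.

Lemma klein_mulA : associative klein_mul.
Proof.
move=> [i j] [i' j'] [i'' j'']; congr pair; rewrite /= ?addrA // /twist.
by case: ifP; case: ifP; case: ifP; lia.
Qed.
Lemma klein_mul1 : left_id klein_one klein_mul.
Proof. by move=> [i j]; congr pair; exact: add0r. Qed.
Lemma klein_mulr1 : right_id klein_one klein_mul.
Proof.
move=> [i j]; congr pair; last exact: addr0.
by rewrite /= /twist; case: ifP; lia.
Qed.
Lemma klein_mulV : left_inverse klein_one klein_inv klein_mul.
Proof.
move=> [i j]; congr pair; last exact: addNr.
by rewrite /= /twist; do 2?case: ifP; lia.
Qed.
Lemma klein_mulrV : right_inverse klein_one klein_inv klein_mul.
Proof.
move=> [i j]; congr pair; last exact: addrN.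
by rewrite /= /twist; do 2?case: ifP; lia.
Qed.

HB.instance Definition _ := isGroup.Build klein
  klein_mulA klein_mul1 klein_mulr1 klein_mulV klein_mulrV.

Definition prodg (G H : groupType) : groupType := (G * H)%type.

Section Isomorphisms.
Implicit Types G H K : groupType.

Lemma isog_intro G H (f : G -> H) (g : H -> G) :
  {morph f : x y / x * y} -> cancel f g -> cancel g f -> isog G H.
Proof.
move=> fM fg gf.
pose fm := HB.pack_for {multiplicative G -> H} f (isMultiplicative.Build G H f fM).
by exists fm; exists g.
Qed.

Lemma isogP G H : isog G H -> exists (f : G -> H) (g : H -> G),
  [/\ {morph f : x y / x * y}, {morph g : x y / x * y}, cancel f g & cancel g f].
Proof.
move=> [f [g fg gf]]; exists f, g; split=> //; first exact: gmulfM.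
by move=> x y; apply: (can_inj fg); rewrite gmulfM !gf.
Qed.

Lemma isog_refl G : isog G G.
Proof. exact: (@isog_intro _ _ id id). Qed.

Lemma isog_sym G H : isog G H -> isog H G.
Proof. by move=> /isogP[f [g [fM gM fg gf]]]; exact: (isog_intro gM gf fg). Qed.

Lemma isog_trans G H K : isog G H -> isog H K -> isog G K.
Proof.
move=> /isogP[f [g [fM gM fg gf]]] /isogP[f' [g' [fM' gM' fg' gf']]].
apply: (@isog_intro _ _ (f' \o f) (g \o g')); try exact: can_comp.
by move=> x y; rewrite /= fM fM'.
Qed.

Lemma isog_prod G G' H H' : isog G G' -> isog H H' ->
  isog (prodg G H) (prodg G' H').
Proof.
move=> /isogP[f [g [fM gM fg gf]]] /isogP[f' [g' [fM' gM' fg' gf']]].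
apply: (@isog_intro (prodg G H) (prodg G' H')
  (fun x => (f x.1, f' x.2)) (fun x => (g x.1, g' x.2))).
- by move=> x y; rewrite /= fM fM'.
- by move=> [x y]; rewrite /= fg fg'.
- by move=> [x y]; rewrite /= gf gf'.
Qed.

Lemma isog_prodC G H : isog (prodg G H) (prodg H G).
Proof.
by apply: (@isog_intro (prodg G H) (prodg H G) (fun x => (x.2, x.1))
  (fun x => (x.2, x.1))) => // -[].
Qed.

Lemma isog_prodA G H K : isog (prodg G (prodg H K)) (prodg (prodg G H) K).
Proof.
by apply: (@isog_intro (prodg G (prodg H K)) (prodg (prodg G H) K)
  (fun x => ((x.1, x.2.1), x.2.2)) (fun x => (x.1.1, (x.1.2, x.2))))
  => [//|[? []]|[[]]].
Qed.

Lemma isog_prodCA G H K : isog (prodg G (prodg H K)) (prodg H (prodg G K)).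
Proof.
apply: isog_trans (isog_prodA _ _ _) _; apply: isog_trans (isog_sym (isog_prodA _ _ _)).
by apply: isog_prod (isog_refl _); exact: isog_prodC.
Qed.

Lemma isog_trivg_prod G : isog (prodg trivg G) G.
Proof.
apply: (@isog_intro (prodg trivg G) G snd (pair (ord0 : trivg))) => //.
by move=> [i x]; rewrite [i]ord1.
Qed.

Lemma gpow_isog G H n : isog G H -> isog (gpow G n) (gpow H n).
Proof.
move=> /isogP[f [g [fM gM fg gf]]].
apply: (@isog_intro (gpow G n) (gpow H n) (fun v => [ffun i => f (v i)])
  (fun v => [ffun i => g (v i)])).
- by move=> x y; apply/ffunP => i; rewrite !ffunE fM.
- by move=> x; apply/ffunP => i; rewrite !ffunE fg.
- by move=> x; apply/ffunP => i; rewrite !ffunE gf.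
Qed.

Lemma gpow0_isog G H : isog (prodg (gpow G 0) H) H.
Proof.
apply: (@isog_intro (prodg (gpow G 0) H) H snd (pair (1 : gpow G 0))) => //.
by move=> [v x]; congr pair; apply/ffunP => -[].
Qed.

Lemma dprodg_split n (Gi : 'I_n.+1 -> groupType) :
  isog (dprodg Gi) (prodg (Gi ord0) (dprodg (fun i => Gi (lift ord0 i)))).
Proof.
pose P := prodg (Gi ord0) (dprodg (fun i => Gi (lift ord0 i))).
pose f (x : dprodg Gi) : P := (x ord0, [ffun i => x (lift ord0 i)]).
(* The type of a coordinate depends on its index, so the inverse transports along an equality of
   indices. Such equalities have unique proofs, which makes the transport trivial in [h0] and
   [hS]. *)
pose h (y : P) i : Gi i := match unliftP ord0 i with
  | UnliftSome j e => eq_rect_r (fun k => Gi k : Type) (y.2 j) e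
  | UnliftNone e => eq_rect_r (fun k => Gi k : Type) y.1 e end.
have h0 y : h y ord0 = y.1.
  rewrite /h; case: unliftP => [j e|e]; first by have := congr1 val e.
  by rewrite (eq_irrelevance e erefl).
have hS y j : h y (lift ord0 j) = y.2 j.
  rewrite /h; case: unliftP => [k e|e]; last by have := congr1 val e.
  have jk := lift_inj e; move: e; rewrite -jk => e.
  by rewrite (eq_irrelevance e erefl).
apply: (@isog_intro _ P f (fun y => [ffun i => h y i])).
- by move=> x y; congr pair; rewrite ?ffunE //; apply/ffunP => i; rewrite !ffunE.
- move=> x; apply/ffunP => i; rewrite ffunE.
  by case: (unliftP ord0 i) => [j ->|->]; rewrite ?h0 ?hS //= ffunE.
- move=> [y v]; congr pair; first by rewrite ffunE h0.
  by apply/ffunP => j; rewrite !ffunE hS.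
Qed.

Lemma gpow_split G n : isog (gpow G n.+1) (prodg G (gpow G n)).
Proof.
apply: (@isog_intro _ (prodg G (gpow G n))
  (fun v : gpow G n.+1 => (v ord0, [ffun i => v (lift ord0 i)]))
  (fun y => [ffun i => oapp (y.2 : gpow G n) y.1 (unlift ord0 i)])).
- by move=> x y; congr pair; rewrite ?ffunE //; apply/ffunP => i; rewrite !ffunE.
- move=> x; apply/ffunP => i; rewrite ffunE.
  by case: (unliftP ord0 i) => [j ->|->]; rewrite //= ffunE.
- move=> [y v]; congr pair; first by rewrite ffunE unlift_none.
  by apply/ffunP => j; rewrite !ffunE liftK.
Qed.

End Isomorphisms.

(** * Words and normal forms in the Klein bottle group *)

Definition klein_a : klein := (1, 0)%R.
Definition klein_b : klein := (0, 1)%R.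

Lemma klein_expz_a k : expz klein_a k = (k, 0%R).
Proof.
elim/int_ind: k => [//|k IH|k IH]; first by rewrite expzS IH intS; congr pair.
by rewrite expzNS IH intS opprD; congr pair.
Qed.

Lemma klein_expz_b k : expz klein_b k = (0%R, k).
Proof.
elim/int_ind: k => [//|k IH|k IH]; first by rewrite expzS IH intS; congr pair.
by rewrite expzNS IH intS opprD; congr pair.
Qed.

Lemma kleinE (x : klein) : x = expz klein_a x.1 * expz klein_b x.2.
Proof.
case: x => i j; rewrite klein_expz_a klein_expz_b.
by congr pair; rewrite /= ?addr0 ?add0r.
Qed.

Section KleinPresentation.

Definition klein_rels : set (word 'I_2) :=
  [set [:: (ord_max, false); (ord0, false); (ord_max, true); (ord0, false)]].

Definition klein_letter (l : 'I_2 * bool) : klein :=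
  let e : int := if l.2 then (-1)%R else 1%R in
  if l.1 == ord0 then (e, 0%R) else (0%R, e).

Definition klein_eval (u : word 'I_2) : klein :=
  foldr (fun l x => klein_letter l * x) 1 u.

Lemma klein_eval_cat u v : klein_eval (u ++ v) = klein_eval u * klein_eval v.
Proof. by elim: u => [|l u IH] /=; rewrite ?mul1g // IH mulgA. Qed.

Lemma klein_eval_word_eq u v :
  word_eq klein_rels u v -> klein_eval u = klein_eval v.
Proof.
elim=> //= [u1 v1 w1 _ -> _ -> //|u1 u2 v1 v2 _ IHu _ IHv|x e|r ->].
- by rewrite !klein_eval_cat IHu IHv.
- by case: x => -[|[|//]] i; case: e.
- by [].
Qed.

Let A : presented klein_rels := pres_class klein_rels [:: (ord0, false)].
Let B : presented klein_rels := pres_class klein_rels [:: (ord_max, false)].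

Lemma pres_class_cat u v : pres_class klein_rels (u ++ v) =
  (pres_class klein_rels u : presented klein_rels) * pres_class klein_rels v.
Proof. by rewrite -pres_classM. Qed.

Lemma pres_class_inv x :
  pres_class klein_rels [:: (x, true)] = (pres_class klein_rels [:: (x, false)])^-1
    :> presented klein_rels.
Proof.
apply: (mulgI (pres_class klein_rels [:: (x, false)])).
rewrite -pres_class_cat mulgV; apply/eqP/pres_classP; exact: word_eq_cancel.
Qed.

Lemma klein_relation : B * A = A^-1 * B.
Proof.
have /(congr1 (fun x => x * A^-1 * B)) : B * A * B^-1 * A = 1.
  rewrite -pres_class_inv /A /B -3!pres_class_cat; apply/eqP/pres_classP.
  by apply: word_eq_rel.
by rewrite /= mulgK mulgVK mul1g.
Qed.

Lemma conj_klein i : B * expz A i = expz A (- i) * B.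
Proof.
elim/int_ind: i => [|i IH|i IH]; first by rewrite mulg1 mul1g.
  by rewrite expzS mulgA klein_relation -mulgA IH mulgA expzNS.
have rV : B * A^-1 = A * B.
  by apply: (mulgI A^-1); rewrite mulgA -klein_relation mulgK mulKg.
by rewrite opprK in IH *; rewrite expzNS mulgA rV -mulgA IH mulgA expzS.
Qed.

(** This is the product rule of [klein], derived from the relator alone. *)
Lemma conj_klein_expz i j : expz B j * expz A i = expz A (twist j i) * expz B j.
Proof.
have rV k : B^-1 * expz A k = expz A (- k) * B^-1.
  by apply: (mulgI B); rewrite mulVKg mulgA conj_klein opprK mulgK.
elim/int_ind: j i => [|j IH|j IH] i; first by rewrite mulg1 mul1g /twist dvdz0.
  rewrite expzS -mulgA IH !mulgA conj_klein; congr (expz A _ * _ * _).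
  by rewrite /twist; do 2!case: ifP; lia.
rewrite expzNS -mulgA IH !mulgA rV; congr (expz A _ * _ * _).
by rewrite /twist; do 2!case: ifP; lia.
Qed.

(** The map (i, j) -> A^i B^j is multiplicative by the commutation rule. Its inverse evaluates a
    representing word in [klein], where the relator holds; one composite is checked on generators,
    the other by induction on words. *)
Lemma NS2_klein : isog NS2 klein.
Proof.
apply: isog_sym; pose g (x : klein) : NS2 := expz A x.1 * expz B x.2.
have gM : {morph g : x y / x * y}.
  move=> [i j] [i' j']; rewrite /g /= !expzD -!mulgA; congr (_ * _).
  by rewrite !mulgA; congr (_ * _); rewrite conj_klein_expz.
apply: (@isog_intro klein NS2 g
  (fun x => klein_eval (repr (x : presented klein_rels)))) => //.
  have fM : {morph (fun x : presented klein_rels => klein_eval (repr x)) : x y / x * y}.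
    move=> x y; rewrite -klein_eval_cat; apply: klein_eval_word_eq.
    exact: word_eq_repr.
  have fl l : klein_eval (repr (pres_class klein_rels [:: l])) = klein_letter l.
    by rewrite (klein_eval_word_eq (word_eq_repr _ _)) /= mulg1.
  have fX (x : presented klein_rels) i :
      klein_eval (repr (expz x i)) = expz (klein_eval (repr x)) i.
    elim/int_ind: i => [|i IH|i IH]; first exact: (morph_1 fM).
      by rewrite !expzS fM IH.
    by rewrite !expzNS fM IH (morph_V fM).
  by move=> x; rewrite fM !fX !fl [RHS]kleinE.
have gl l : g (klein_letter l) = pres_class klein_rels [:: l].
  case: l => x e; rewrite /g /klein_letter /=; case: ifPn => [/eqP ->|x0] /=.
    by rewrite mulg1; case: e => //=; rewrite pres_class_inv.
  have -> : x = ord_max by apply: val_inj; case: x x0 => -[|[|]].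
  by rewrite mul1g; case: e => //=; rewrite pres_class_inv.
move=> x; rewrite -[RHS](pres_class_repr (x : presented klein_rels)).
elim: (repr _) => [|l u IH] /=; first exact: mulg1.
by rewrite gM gl IH -pres_class_cat.
Qed.

End KleinPresentation.

(** * Products of Klein, Z and C2 factors, and their mod 2 bases *)

Definition normal_form (l p q : nat) : groupType :=
  prodg (prodg (gpow klein l) (gpow Zgrp p)) (gpow C2 q).

Lemma normal_form_klein l p q :
  isog (normal_form l.+1 p q) (prodg klein (normal_form l p q)).
Proof.
apply: isog_sym; apply: isog_trans (isog_prodA _ _ _) _.
apply: isog_prod (isog_refl _); apply: isog_trans (isog_prodA _ _ _) _.
by apply: isog_prod (isog_refl _); apply: isog_sym; exact: gpow_split.
Qed.

Lemma normal_form_Z l p q :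
  isog (normal_form l p.+1 q) (prodg Zgrp (normal_form l p q)).
Proof.
apply: isog_sym; apply: isog_trans (isog_prodA _ _ _) _.
apply: isog_prod (isog_refl _); apply: isog_trans (isog_prodCA _ _ _) _.
by apply: isog_prod (isog_refl _) _; apply: isog_sym; exact: gpow_split.
Qed.

Lemma normal_form_C2 l p q :
  isog (normal_form l p q.+1) (prodg C2 (normal_form l p q)).
Proof.
apply: isog_sym; apply: isog_trans (isog_prodCA _ _ _) _.
by apply: isog_prod (isog_refl _) _; apply: isog_sym; exact: gpow_split.
Qed.

Lemma dprodg_normal_form n (Gi : 'I_n -> groupType) :
  (forall i, euclidean_surface_group (Gi i)) ->
  exists l p q, isog (dprodg Gi) (normal_form l p q).
Proof.
elim: n Gi => [|n IH] Gi hGi.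
  exists 0%N, 0%N, 0%N; apply: (@isog_intro _ (normal_form 0 0 0) (fun=> 1) (fun=> 1)).
  - by move=> x y; rewrite mulg1.
  - by move=> x; apply/ffunP => -[].
  - by move=> [[u v] w]; congr (_, _, _); apply/ffunP => -[].
have [l [p [q E]]] := IH (fun i => Gi (lift ord0 i)) (fun i => hGi _).
have step (H K : groupType) : isog (Gi ord0) H ->
    isog (prodg H (normal_form l p q)) K -> isog (dprodg Gi) K.
  move=> GH HK; apply: isog_trans (dprodg_split _) _.
  exact: isog_trans (isog_prod GH E) HK.
case: (hGi ord0) => [[] H|H].
- by exists l, p, q; apply: step H _; exact: isog_trivg_prod.
- by exists l, p.+1, q; apply: step H _; apply: isog_sym; exact: normal_form_Z.
- exists l, p.+2, q; apply: step H _; apply: isog_sym.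
  apply: isog_trans (normal_form_Z _ _ _) _.
  apply: isog_trans (isog_prodA _ _ _).
  by apply: isog_prod (isog_refl _) _; exact: normal_form_Z.
- by exists l, p, q.+1; apply: step H _; apply: isog_sym; exact: normal_form_C2.
- exists l.+1, p, q; apply: step (isog_trans H NS2_klein) _.
  by apply: isog_sym; exact: normal_form_klein.
Qed.

(** Here the dual families are used for groups that need not be free abelian: the [t i] generate [G]
    and induce a basis of its largest elementary abelian 2-quotient. *)
Definition mod2_free (G : groupType) : Prop :=
  exists (I : finType) (t : I -> G) (chi : I -> G -> 'F_2),
    mod2_basis [set: G] t chi.

Lemma mod2_free_fg (G : groupType) : mod2_free G -> exists t, generated t = [set: G].
Proof. by move=> [I [t [chi [tG _ _]]]]; exists [seq t i | i <- enum I]. Qed.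

Lemma mod2_free_isog (G H : groupType) : isog G H -> mod2_free G -> mod2_free H.
Proof.
move=> /isogP[f [g [fM gM fg gf]]] [I [t [chi [tG chiD chit]]]].
exists I, (f \o t), (fun i => chi i \o g); split.
- rewrite (map_comp f t) generated_map // tG.
  by apply/seteqP; split=> // x _; exists (g x).
- by move=> i x y _ _; rewrite /= gM chiD.
- by move=> i j; rewrite /= fg.
Qed.

Lemma generated_prod (G H : groupType) (t : seq G) (u : seq H)
    (s : seq (prodg G H)) :
  generated t = [set: G] -> generated u = [set: H] ->
  (forall x, x \in t -> generated s (x, 1)) ->
  (forall y, y \in u -> generated s (1, y)) -> generated s = [set: prodg G H].
Proof.
move=> tG uH st su; apply/seteqP; split=> // -[x y] _.
have -> : (x, y) = ((x, 1) : prodg G H) * (1, y).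
  by congr pair; rewrite /= ?mulg1 ?mul1g.
have sG := subgroup_generated s.
apply: generatedM.
  have fM : {morph (fun x => (x, 1) : prodg G H) : a b / a * b}.
    by move=> a b; congr pair; rewrite /= mulg1.
  have : [set: G] x by []; rewrite -tG; move: x.
  exact: (generated_min (subgroup_preim fM sG)).
have fM : {morph (fun y => (1, y) : prodg G H) : a b / a * b}.
  by move=> a b; congr pair; rewrite /= mulg1.
have : [set: H] y by []; rewrite -uH; move: y.
exact: (generated_min (subgroup_preim fM sG)).
Qed.

Lemma mod2_free_prod (G H : groupType) :
  mod2_free G -> mod2_free H -> mod2_free (prodg G H).
Proof.
move=> [I [t [chi [tG chiD chit]]]] [J [u [psi [uH psiD psiu]]]].
have chi1 i : chi i 1 = 0%R by exact: additive_on1 (@subgroupT G) (chiD i).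
have psi1 j : psi j 1 = 0%R by exact: additive_on1 (@subgroupT H) (psiD j).
exists (I + J)%type.
exists (fun k => match k with inl i => (t i, 1) | inr j => (1, u j) end).
exists (fun k x => match k with inl i => chi i x.1 | inr j => psi j x.2 end).
split.
- apply: (generated_prod tG uH) => _ /mapP[k _ ->]; apply: mem_generated.
    by apply/mapP; exists (inl k); rewrite ?mem_enum.
  by apply/mapP; exists (inr k); rewrite ?mem_enum.
- by move=> [i|j] x y _ _; rewrite /= ?chiD ?psiD.
- by move=> [i|j] [i'|j'] /=; rewrite ?chi1 ?psi1 ?chit ?psiu.
Qed.

Lemma mod2_free_gpow (G : groupType) n : mod2_free G -> mod2_free (gpow G n).
Proof.
move=> Gf; elim: n => [|n IH].
  exists void, (fun=> 1), (fun _ _ => 0%R); split; try by case.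
  rewrite (_ : [seq _ | i <- _] = [::]); last by rewrite enumT unlock.
  rewrite generated_nil; apply/seteqP; split=> // x _.
  by apply/ffunP => -[].
by apply: mod2_free_isog (isog_sym (gpow_split _ _)) _; exact: mod2_free_prod.
Qed.

Lemma enum_unit_map (T : Type) (f : unit -> T) :
  [seq f i | i <- enum {: unit}] = [:: f tt].
Proof. by rewrite enumT unlock. Qed.

Lemma expz_int (x : Zgrp) : expz (1%R : Zgrp) x = x.
Proof.
elim/int_ind: x => [//|x IH|x IH]; first by rewrite expzS IH intS.
by rewrite expzNS IH intS opprD.
Qed.

Lemma mod2_free_Z : mod2_free Zgrp.
Proof.
exists unit, (fun=> 1%R : int), (fun _ x => (x : int)%:~R%R); split=> //.
- rewrite enum_unit_map; apply/seteqP; split=> // x _.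
  rewrite -(expz_int x); apply: (subgroup_expz _ (subgroup_generated _)).
  by apply: mem_generated; rewrite mem_head.
- by move=> _ x y _ _; exact: rmorphD.
Qed.

Lemma mod2_free_C2 : mod2_free C2.
Proof.
exists unit, (fun=> 1%R : 'Z_2), (fun _ x => x); split=> //.
rewrite enum_unit_map; apply/seteqP; split=> // x _.
have : x = 1 \/ x = (1%R : 'Z_2).
  by case: x => -[|[|//]] i; [left | right]; apply: val_inj.
case=> ->; first exact: generated1.
by apply: mem_generated; rewrite mem_head.
Qed.


(** Signs vanish mod 2; hence the exponent of a mod 2 is a homomorphism on [klein]. *)
Lemma twist_F2 j i : ((twist j i)%:~R = i%:~R :> 'F_2)%R.
Proof. by rewrite /twist; case: ifP => // _; rewrite rmorphN /= oppr_pchar2. Qed.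

Lemma generated_klein : generated [:: klein_a; klein_b] = [set: klein].
Proof.
apply/seteqP; split=> // x _; rewrite (kleinE x); apply: generatedM.
  apply: (subgroup_expz _ (subgroup_generated _)).
  by apply: mem_generated; rewrite mem_head.
apply: (subgroup_expz _ (subgroup_generated _)).
by apply: mem_generated; rewrite !inE eqxx orbT.
Qed.

Lemma mod2_free_klein : mod2_free klein.
Proof.
exists bool, (fun b => if b then klein_a else klein_b),
  (fun b x => if b then (x.1%:~R)%R else (x.2%:~R)%R); split.
- by rewrite enumT unlock /=; exact: generated_klein.
- by move=> [] x y _ _ /=; rewrite rmorphD //= twist_F2.
- by move=> [] [].
Qed.

(** * Fixed subgroups in the torsion-free case *)

Lemma subgroup_Fix (G : groupType) (phi : G -> G) :
  {morph phi : x y / x * y} -> subgroup (Fix phi).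
Proof.
move=> phiM; rewrite /Fix; split=> /=; first exact: morph_1.
- by move=> x y xE yE; rewrite phiM xE yE.
- by move=> x xE; rewrite morph_V // xE.
Qed.

Lemma F2_cases (k : 'F_2) : k = 0%R \/ k = 1%R.
Proof. by case: k => -[|[|//]] i; [left | right]; apply: val_inj. Qed.

(* For a basis [s] of a pure subgroup [B] of Z^l, a combination of the [s i] that
   vanishes mod 2 is twice an element of [B], so its coordinates are even. *)
Lemma pure_mod2_free l (B : set (gpow Zgrp l)) (I : finType) s eta :
  @mod2_basis _ B I s eta -> (forall x, B (x * x) -> B x) ->
  exists psi : I -> 'rV['F_2]_l -> 'F_2,
    (forall i, {morph psi i : u v / (u + v)%R}) /\
    forall i j, psi i (\row_k (s j k : int)%:~R)%R = (i == j)%:R%R.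
Proof.
move=> [sB etaD etas] Bpure.
have BG : subgroup B by rewrite -sB; exact: subgroup_generated.
have Bs i : B (s i).
  by rewrite -sB; apply: mem_generated; apply: map_f; rewrite mem_enum.
pose F (x : gpow Zgrp l) : 'rV['F_2]_l := (\row_k (x k : int)%:~R)%R.
have FD x y : F (x * y) = (F x + F y)%R.
  by apply/rowP => k; rewrite !mxE ffunE -rmorphD.
pose X := [tuple F (s (enum_val k)) | k < #|I|].
have XE k : (X`_(k : 'I_#|I|))%R = F (s (enum_val k)).
  by rewrite -tnth_nth tnth_mktuple.
have Xfree : free X.
  apply/freeP => c c0 k.
  (* A linear relation [c] mod 2 lifts to the product [w] of the basis elements with nonzero
     coefficient. *)
  pose y k := if c k == 0%R then 1 else s (enum_val k).
  have By i : B (y i) by rewrite /y; case: ifP => // _; case: BG.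
  pose w := \prod_(k < #|I|) y k.
  have Bw : B w by exact: (subgroup_prod BG).
  have Fw : F w = 0%R.
    rewrite /w (@additive_on_prod _ [set: _] _ F) //.
    rewrite -[RHS]c0; apply: eq_bigr => i _; rewrite XE /y.
    case: (F2_cases (c i)) => ->; rewrite ?eqxx ?scale0r ?scale1r //.
    by rewrite (@additive_on1 _ [set: _] _ F).
  (* All coordinates of [w] are even, so [w] is a square in Z^l, and by purity its root lies in
     [B]. *)
  have [x xw] : exists x : gpow Zgrp l, w = x * x.
    have wk i : exists z : int, (w i : int) = (z * 2)%R.
      by apply: odd_F2; have /rowP/(_ i) := Fw; rewrite !mxE.
    have [z zE] := choice wk; exists [ffun i => z i : Zgrp].
    apply/ffunP => i; rewrite !ffunE; have := zE i.
    by change ((w i : int) = z i * 2 -> (w i : int) = z i + z i)%R; lia.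
  have Bx : B x by apply: Bpure; rewrite -xw.
  (* The dual map reads off the coefficient [c k] from [w], but it vanishes on squares of elements
     of [B]. *)
  have etaw : eta (enum_val k) w = c k.
    rewrite (additive_on_prod BG (etaD _)) // (bigD1 k) //= big1 => [|i ik].
      rewrite addr0 /y; case: (F2_cases (c k)) => ->; rewrite ?eqxx ?etas ?eqxx //=.
      exact: (additive_on1 BG (etaD _)).
    rewrite /y; case: ifP => _; first exact: (additive_on1 BG (etaD _)).
    by rewrite etas (inj_eq enum_val_inj) eq_sym (negbTE ik).
  rewrite -etaw xw etaD //.
  by case: (F2_cases (eta (enum_val k) x)) => ->; apply: val_inj.
exists (fun i u => coord X (enum_rank i) u); split.
  by move=> i u v; rewrite raddfD.
move=> i j; rewrite -[j]enum_rankK -/(F _) -XE coord_free //.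
by rewrite enum_rankK (inj_eq enum_rank_inj) eq_sym.
Qed.

(** The torsion-free argument in abstract form: [iota] identifies Z^l with the kernel A of [f], the
    [chi i] extend the coordinates of A mod 2 to all of [G], and each element of A is inverted by
    some conjugation. *)
Lemma compressed_Fix_split (G : groupType) (l N : nat) (chi : 'I_l -> G -> 'F_2)
    (f : G -> gpow Zgrp N) (iota : gpow Zgrp l -> G) (phi : G -> G) :
  (exists t, generated t = [set: G]) ->
  (forall i, {morph chi i : x y / x * y >-> (x + y)%R}) ->
  {morph f : x y / x * y} -> {morph iota : u v / u * v} -> injective iota ->
  (forall u, f (iota u) = 1) -> (forall x, f x = 1 -> exists u, x = iota u) ->
  (forall u i, chi i (iota u) = (u i : int)%:~R%R) ->
  (forall x, f x = 1 -> exists y, y * x * y^-1 = x^-1) ->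
  {morph phi : x y / x * y} -> compressed (Fix phi).
Proof.
move=> Gfg chiD fM iotaM iota_inj fiota kerf chi_iota kerJ phiM.
apply/compressedP => // t Ht.
have HG := subgroup_Fix phiM; set H := Fix phi in HG Ht *.
(* Applying [phi] to y x y^-1 = x^-1 and passing to the abelian target of [f] shows that f (phi x)
   equals its own inverse, hence is trivial in Z^N. *)
have phi_ker x : f x = 1 -> f (phi x) = 1.
  move=> /kerJ[y yx]; have := congr1 (f \o phi) yx.
  rewrite /= !phiM !(morph_V phiM) !fM !(morph_V fM) => fphi; apply/ffunP => i.
  have /ffunP/(_ i) := fphi; rewrite !ffunE.
  set a : int := f (phi x) i; set b : int := f (phi y) i.
  move=> ab; have {}ab : (b + a - b = - a)%R by exact: ab.
  by change (a = 0%R); lia.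
pose B : set (gpow Zgrp l) := iota @^-1` H.
have BG : subgroup B by exact: subgroup_preim.
(* [phi] sends x into A, and its image there has the same square as x; square roots in Z^l are
   unique. *)
have Bpure x : B (x * x) -> B x.
  rewrite /B /H /preimage /Fix /= iotaM phiM.
  have [y ->] : exists y, phi (iota x) = iota y by exact/kerf/phi_ker/fiota.
  rewrite -!iotaM => /iota_inj xy; congr iota; apply/ffunP => i.
  have /ffunP/(_ i) := xy; rewrite !ffunE => e.
  have {}e : ((y i : int) + y i = (x i : int) + x i)%R by exact: e.
  by change ((y i : int) = x i); lia.
have [I [s [eta sB]]] := mod2_coordinates BG.
have [psi [psiD psis]] := pure_mod2_free sB Bpure.
have [sgen _ _] := sB.
have Bs i : B (s i).
  by rewrite -sgen; apply: mem_generated; apply: map_f; rewrite mem_enum.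
have KG : subgroup (f @` generated t) by exact/subgroup_im/subgroup_generated.
have [J [u [theta [ugen thetaD thetau]]]] := mod2_coordinates KG.
(* Lifts to K = [generated t] of the basis of its image under [f]. *)
have [x xP] : exists x : J -> G, forall j, generated t (x j) /\ f (x j) = u j.
  have ex j : exists x, generated t x /\ f x = u j.
    suff [z tz zu] : (f @` generated t) (u j) by exists z.
    by rewrite -ugen; apply: mem_generated; apply: map_f; rewrite mem_enum.
  by have [x] := choice ex; exists x.
pose c g : 'rV['F_2]_l := (\row_k chi k g)%R.
have cD g h : c (g * h) = (c g + c h)%R by apply/rowP => k; rewrite !mxE chiD.
have theta1 j : theta j 1 = 0%R by exact: additive_on1 KG (thetaD j).
(* The homomorphisms dual to the [s i] are corrected by multiples of the [theta j] so as to vanish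
   on the lifts [x j]; on A the correction is zero. *)
have IJ : (#|{: I + J}| <= size t)%N.
  apply: (@dual_size G (I + J)%type t
    (fun k g => match k with
      | inl i => psi i (c g) - \sum_j psi i (c (x j)) * theta j (f g)
      | inr j => theta j (f g) end)%R
    (fun k => match k with inl i => iota (s i) | inr j => x j end)).
  - have thD j g h : generated t g -> generated t h ->
        theta j (f (g * h)) = (theta j (f g) + theta j (f h))%R.
      by move=> tg th; rewrite fM thetaD.
    move=> [i|j] g h tg th; last exact: thD.
    rewrite cD psiD (eq_bigr (fun j => psi i (c (x j)) * theta j (f g) +
      psi i (c (x j)) * theta j (f h))%R); last first.
      by move=> j _; rewrite thD // mulrDr.
    by rewrite big_split /= opprD addrACA.
  - by move=> [i|j]; [apply: Ht; exact: Bs | have [] := xP j].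
  - have ciota i : c (iota (s i)) = (\row_k (s i k : int)%:~R)%R.
      by apply/rowP => k; rewrite !mxE chi_iota.
    move=> [i|j] [i'|j'] /=; rewrite ?fiota ?theta1 ?(xP _).2 ?thetau //.
    + by rewrite ciota psis big1 ?subr0 // => j _; rewrite theta1 mulr0.
    + rewrite (bigD1 j') //= ?thetau eqxx mulr1 big1 ?addr0 ?subrr //.
      by move=> j jj'; rewrite thetau (negbTE jj') mulr0.
(* The image of [H] lies in that of K, so |J| generators suffice for it; the intersection of [H]
   with A is generated by |I| elements. *)
apply: (gen_le_leq IJ); rewrite card_sum addnC; apply: (gen_le_hom fM HG).
  rewrite cardE -(size_map u); apply: gen_le_abelian.
  - by move=> ? ? _ _; exact: gpowZC.
  - exact: subgroup_im.
  - by rewrite ugen => _ [g /Ht tg <-]; exists g.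
exists (map iota [seq s i | i <- enum I]); first by rewrite !size_map -enumT -cardE.
rewrite generated_map // sgen; apply/seteqP; split.
  by move=> _ [v Bv <-]; split; [exact: Bv | exact: fiota].
by move=> g [Hg /kerf[v gv]]; exists v; rewrite // /B /preimage /= -gv.
Qed.

(** * The compressed cases *)

Definition all_Fix_compressed (G : groupType) : Prop :=
  forall phi : G -> G, {morph phi : x y / x * y} -> compressed (Fix phi).

Definition aut_Fix_compressed (G : groupType) : Prop :=
  forall phi : G -> G, {morph phi : x y / x * y} -> bijective phi ->
    compressed (Fix phi).

Section Transport.
Variables (G H : groupType) (f : G -> H) (g : H -> G).
Hypotheses (fM : {morph f : x y / x * y}) (gM : {morph g : x y / x * y}).
Hypotheses (fg : cancel f g) (gf : cancel g f).

(** [f] maps [Fix phi] onto the fixed subgroup of the conjugate endomorphism; generating sequences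
    are carried over by [f] and back by [g]. *)
Lemma compressed_Fix_conj (phi : G -> G) : mod2_free G ->
  compressed (Fix (f \o phi \o g)) -> compressed (Fix phi).
Proof.
move=> Gf; have Hf : mod2_free H by apply: mod2_free_isog Gf; exact: isog_intro fg gf.
move=> /(compressedP _ (mod2_free_fg Hf)) HP.
apply/(compressedP _ (mod2_free_fg Gf)) => t Ht.
have [|s st sH] := HP (map f t).
  move=> x; rewrite /Fix /= => xE; rewrite generated_map //; exists (g x) => //.
  by apply: Ht; rewrite /Fix /= -{2}xE fg.
exists (map g s); first by rewrite size_map (leq_trans st) // size_map.
rewrite generated_map // sH /Fix; apply/seteqP; split=> [_ [x /= xE <-]|x /= xE].
  by rewrite /= -{2}xE fg.
by exists (f x); rewrite /= fg // xE.
Qed.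

End Transport.

Lemma all_Fix_compressed_isog (G H : groupType) : mod2_free G -> isog G H ->
  all_Fix_compressed H -> all_Fix_compressed G.
Proof.
move=> Gf /isogP[f [g [fM gM fg gf]]] HP phi phiM.
apply: (compressed_Fix_conj fM gM fg gf Gf); apply: HP => x y.
by rewrite /= gM phiM fM.
Qed.

Lemma aut_Fix_compressed_isog (G H : groupType) : mod2_free G -> isog G H ->
  aut_Fix_compressed H -> aut_Fix_compressed G.
Proof.
move=> Gf /isogP[f [g [fM gM fg gf]]] HP phi phiM phi_bij.
apply: (compressed_Fix_conj fM gM fg gf Gf); apply: HP => [x y|].
  by rewrite /= gM phiM fM.
by apply: bij_comp; [apply: bij_comp phi_bij; exists g | exists f].
Qed.

Lemma mod2_free_normal_form l p q : mod2_free (normal_form l p q).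
Proof.
apply: mod2_free_prod; first apply: mod2_free_prod; apply: mod2_free_gpow.
- exact: mod2_free_klein.
- exact: mod2_free_Z.
- exact: mod2_free_C2.
Qed.

Lemma all_Fix_compressed_abelian (G : groupType) : mod2_free G ->
  (forall x y : G, x * y = y * x) -> all_Fix_compressed G.
Proof.
move=> Gf GC phi phiM; apply/(compressedP _ (mod2_free_fg Gf)) => t Ht.
by apply: gen_le_abelian => //; exact: subgroup_Fix.
Qed.

Lemma gpowC (G : groupType) n : (forall x y : G, x * y = y * x) ->
  forall x y : gpow G n, x * y = y * x.
Proof. by move=> GC x y; apply/ffunP => i; rewrite !ffunE GC. Qed.

Lemma C2C (x y : C2) : x * y = y * x.
Proof. exact: addrC. Qed.

Lemma all_Fix_compressed_euc1 p q :
  all_Fix_compressed (prodg (gpow Zgrp p) (gpow C2 q)).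
Proof.
apply: all_Fix_compressed_abelian.
  by apply: mod2_free_prod; apply: mod2_free_gpow;
    [exact: mod2_free_Z | exact: mod2_free_C2].
move=> [x y] [x' y']; congr pair; first exact: gpowZC.
exact: (gpowC C2C).
Qed.

(** The exponent of b is a homomorphism to Z whose kernel Z x C2^q is abelian, and conjugation acts
    on this kernel as the identity or as inversion. *)
Lemma all_Fix_compressed_euc2 q : all_Fix_compressed (prodg klein (gpow C2 q)).
Proof.
have Gf : mod2_free (prodg klein (gpow C2 q)).
  apply: mod2_free_prod; first exact: mod2_free_klein.
  by apply: mod2_free_gpow; exact: mod2_free_C2.
move=> phi phiM; apply/(compressedP _ (mod2_free_fg Gf)) => t Ht.
apply: (@gen_le_hom_int _ (fun x : prodg klein (gpow C2 q) => x.1.2 : Zgrp)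
  t _ _ _ _ (subgroup_Fix phiM) Ht) => //.
- move=> [[i j] y] [[i' j'] y'] /= -> ->; congr pair; last exact: (gpowC C2C).
  by congr pair; rewrite /= /twist /= addrC.
- move=> [[i j] y] [[i' j'] y'] /= j'0; have {j'0} -> : j' = 0%R := j'0.
  (* Inversion is trivial on C2^q, so there it agrees with the trivial conjugation action. *)
  have yV : y'^-1 = y'.
    by apply/ffunP => k; rewrite !ffunE; case: (F2_cases (y' k)) => ->; apply: val_inj.
  have yJ : y * y' * y^-1 = y' by rewrite (gpowC C2C y) mulgK.
  case: (boolP (2 %| j)%Z) => j2; [left | right].
    congr pair; last exact: yJ.
    by congr pair; rewrite /= /twist ?addr0 ?j2; do ?case: ifP; lia.
  congr pair; last exact: etrans yJ (esym yV).
  by congr pair; rewrite /= /twist ?addr0 ?(negbTE j2) ?dvdz0; do ?case: ifP; lia.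
Qed.

Lemma all_Fix_compressed_euc4 l p :
  all_Fix_compressed (prodg (gpow klein l) (gpow Zgrp p)).
Proof.
set G := prodg _ _ => phi phiM.
have Gf : mod2_free G.
  by apply: mod2_free_prod; apply: mod2_free_gpow;
    [exact: mod2_free_klein | exact: mod2_free_Z].
pose chi (i : 'I_l) (x : G) : 'F_2 := (((x.1 : gpow klein l) i).1)%:~R%R.
(* [f] records the exponents of b and the Z^p part; its kernel consists of the products of powers of
   the elements a of the factors. *)
pose f (x : G) : gpow Zgrp (l + p) := [ffun k => match split k with
  | inl i => ((x.1 : gpow klein l) i).2 | inr j => (x.2 : gpow Zgrp p) j end].
pose iota (u : gpow Zgrp l) : G := ([ffun i => ((u i, 0%R) : klein)], 1).
have fE x : f x = 1 -> (forall i, ((x.1 : gpow klein l) i).2 = 0%R) /\ x.2 = 1.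
  move=> /ffunP fx; split=> [i|].
    by have := fx (lshift p i); rewrite !ffunE (unsplitK (inl i)).
  by apply/ffunP => j; have := fx (rshift l j); rewrite !ffunE (unsplitK (inr j)).
apply: (@compressed_Fix_split G l (l + p) chi f iota phi (mod2_free_fg Gf)) => //.
- by move=> i x y; rewrite /chi /= ffunE rmorphD /= twist_F2.
- by move=> x y; apply/ffunP => k; rewrite !ffunE; case: split => i //=; rewrite ffunE.
- move=> u v; congr pair; last by rewrite /= mulg1.
  by apply/ffunP => i; rewrite !ffunE; congr pair.
- by move=> u v [/ffunP uv]; apply/ffunP => i; have := uv i; rewrite !ffunE => -[].
- by move=> u; apply/ffunP => k; rewrite !ffunE; case: split => i /=; rewrite !ffunE.
- move=> [v w] /fE[/= v2 ->]; exists [ffun i => (v i).1 : Zgrp]; congr pair.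
  by apply/ffunP => i; rewrite !ffunE [LHS]surjective_pairing v2.
- by move=> u i; rewrite /chi /= ffunE.
(* Conjugation by b in all Klein factors at once inverts the whole kernel. *)
- move=> [v w] /fE[/= v2 ->]; exists ([ffun=> klein_b], 1); congr pair.
    apply/ffunP => i; rewrite !ffunE; have := v2 i; case: (v i) => a b /= ->.
    by congr pair; rewrite /= /twist /=; lia.
  by rewrite /= !mul1g invg1.
Qed.

(** * The other cases *)

(** A mod 2 basis of [X] adapted to a surjection [pi] onto Z: [x0] maps to 1, the other generators
    lie in the kernel, and their dual maps vanish at [x0]. *)
Definition mod2_free_over_Z (X : groupType) : Prop :=
  exists (x0 : X) (J : finType) (t : J -> X) (chi : J -> X -> 'F_2)
    (pi : X -> Zgrp),
  [/\ generated (x0 :: [seq t j | j <- enum J]) = [set: X],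
      {morph pi : x y / x * y} /\ (pi x0 : int) = 1%R,
      forall j, pi (t j) = 1,
      forall j, {morph chi j : x y / x * y >-> (x + y)%R} /\ chi j x0 = 0%R
    & forall i j, chi i (t j) = (i == j)%:R%R].

Lemma mod2_free_over_Z_Z : mod2_free_over_Z Zgrp.
Proof.
exists (1%R : int), void, (fun=> 1), (fun _ _ => 0%R), id.
split=> //; try by case.
apply/seteqP; split=> // x _; rewrite -(expz_int x).
apply: (subgroup_expz _ (subgroup_generated _)).
by apply: mem_generated; rewrite mem_head.
Qed.

Lemma mod2_free_over_Z_klein : mod2_free_over_Z klein.
Proof.
exists klein_b, unit, (fun=> klein_a), (fun _ x => x.1%:~R%R), snd.
split=> //; last by split=> // x y; rewrite rmorphD /= twist_F2.
rewrite enum_unit_map -generated_klein.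
by apply/seteqP; split; apply: generatedS => x; rewrite !inE orbC.
Qed.

Lemma mod2_free_over_Z_prod (X Y : groupType) :
  mod2_free_over_Z X -> mod2_free Y -> mod2_free_over_Z (prodg X Y).
Proof.
move=> [x0 [J [t [chi [pi [tX [piM pix0] pit chiD chit]]]]]].
move=> [I [u [psi [uY psiD psiu]]]].
have psi1 i : psi i 1 = 0%R by exact: additive_on1 (@subgroupT Y) (psiD i).
have chi1 j : chi j 1 = 0%R.
  by apply: (@additive_on1 _ [set: X] _ _ (@subgroupT X)) => x y _ _; exact: (chiD j).1.
exists (x0, 1), (J + I)%type.
exists (fun k => match k with inl j => (t j, 1) | inr i => (1, u i) end).
exists (fun k x => match k with inl j => chi j x.1 | inr i => psi i x.2 end).
exists (pi \o fst); split.
- apply: (generated_prod tX uY) => [x|_ /mapP[i _ ->]]; last first.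
    apply: mem_generated; rewrite inE; apply/orP; right; apply/mapP.
    by exists (inr i); rewrite ?mem_enum.
  rewrite inE => /orP[/eqP ->|/mapP[j _ ->]].
    by apply: mem_generated; rewrite mem_head.
  apply: mem_generated; rewrite inE; apply/orP; right; apply/mapP.
  by exists (inl j); rewrite ?mem_enum.
- by split=> // x y; rewrite /= piM.
- by move=> [j|i] //=; exact: morph_1.
- move=> [j|i]; split=> [x y|] /=; rewrite ?psiD ?psi1 ?(chiD j).2 //.
  exact: (chiD j).1.
- by move=> [j|i] [j'|i'] /=; rewrite ?chi1 ?psi1 ?chit ?psiu.
Qed.

(* The automorphism sends a to ad, b to ab and y in X to y d^(pi y), where d
   generates C2; it fixes the a^i b^j d^e y with j and i + pi y even. This
   subgroup needs one more generator than its overgroup generated by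
   a x0^-1, b x0, d and the t j. *)
Lemma not_aut_Fix_compressed (X : groupType) :
  mod2_free_over_Z X -> mod2_free (prodg (prodg klein C2) X) ->
  ~ aut_Fix_compressed (prodg (prodg klein C2) X).
Proof.
move=> [x0 [J [t [chi [pi [tX [piM pix0] pit chiD chit]]]]]] Gf.
set G := prodg _ _ => GP.
pose par (z : int) : 'F_2 := z%:~R%R.
have parD (z w : int) : par (z + w)%R = (par z + par w)%R by exact: rmorphD.
pose ai (x : G) : int := x.1.1.1; pose bj (x : G) : int := x.1.1.2.
pose de (x : G) : 'F_2 := x.1.2; pose px (x : G) : int := pi x.2.
have F2D (e : 'F_2) : (e + e = 0)%R by case: (F2_cases e) => ->; apply: val_inj.
have par2 : par 2%R = 0%R by rewrite -[2%R]/(1 + 1)%R parD F2D.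
pose mk (i j : int) (e : 'F_2) (y : X) : G := (((i, j) : klein, e : C2), y).
have aiM x y : ai (x * y) = (ai x + twist (bj x) (ai y))%R by [].
have bjM x y : bj (x * y) = (bj x + bj y)%R by [].
have deM x y : de (x * y) = (de x + de y)%R by [].
have pxM x y : px (x * y) = (px x + px y)%R by exact: piM.
have mkM i j e y i' j' e' y' : mk i j e y * mk i' j' e' y' =
  mk (i + twist j i')%R (j + j')%R (e + e')%R (y * y') by [].
(* As (ab)^2 = b^2, the image of b^j is (ab)^j = a^(j mod 2) b^j. *)
pose phi (x : G) : G :=
  mk (ai x + (bj x %% 2)%Z)%R (bj x) (de x + par (ai x + px x))%R x.2.
have phiM : {morph phi : x y / x * y}.
  move=> x y; rewrite /phi mkM; congr mk => //.
    by rewrite aiM bjM /twist; do !case: ifP; lia.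
  rewrite deM aiM pxM !parD /par twist_F2 -/(par _); ring.
(* The exponent of a is restored first; the correction by d has order 2 and undoes itself. *)
pose phi' (x : G) : G := let i := (ai x - (bj x %% 2)%Z)%R in
  mk i (bj x) (de x + par (i + px x))%R x.2.
have phi_bij : bijective phi.
  exists phi' => -[[[i j] e] y]; rewrite /phi' /phi /mk /ai /bj /de /px /=.
    by rewrite addrK -addrA F2D addr0.
  by rewrite subrK -addrA F2D addr0.
have FixE x : Fix phi x <-> (bj x %% 2)%Z = 0%R /\ par (ai x + px x)%R = 0%R.
  rewrite /Fix /phi /=; case: x => -[[i j] e] y; rewrite /mk /ai /bj /de /px /=.
  split=> [[ij ep] | [-> ->]]; last by rewrite !addr0.
  split; first by lia.
  by apply: (addrI e); rewrite ep addr0.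
have FixE2 x : Fix phi x ->
    exists m n : int, bj x = (2 * m)%R /\ (ai x + px x = 2 * n)%R.
  move=> /FixE[j0 /odd_F2[n nE]]; exists (bj x %/ 2)%Z, n; split; first by lia.
  by rewrite nE mulrC.
pose k1 := mk 1%R 0%R 0%R x0^-1; pose k2 := mk 0%R 1%R 0%R x0.
pose k3 := mk 0%R 0%R 1%R 1.
pose u := [:: k1, k2, k3 & [seq mk 0%R 0%R 0%R (t j) | j <- enum J]].
have uG := subgroup_generated u.
have uM x y : generated u x -> generated u y -> generated u (x * y).
  exact: generatedM.
have uV x : generated u x -> generated u x^-1 by exact: generatedV.
have u1 : generated u k1 by apply: mem_generated; rewrite !inE eqxx.
have u2 : generated u k2 by apply: mem_generated; rewrite !inE eqxx !orbT.
have u3 : generated u k3 by apply: mem_generated; rewrite !inE eqxx !orbT.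
have ut j : generated u (mk 0%R 0%R 0%R (t j)).
  apply: mem_generated; do 3!(rewrite inE; apply/orP; right).
  by apply/mapP; exists j; rewrite ?mem_enum.
have mkV i j e y : (mk i j e y)^-1 = mk (- twist j i)%R (- j)%R (- e)%R y^-1 by [].
(* Conjugating a x0^-1 by b x0 gives a^-1 x0^-1. From these two come a^2 and x0^2, and then b^2 from
   (b x0)^2. *)
have u1' : generated u (mk (-1)%R 0%R 0%R x0^-1).
  rewrite (_ : mk _ _ _ _ = k2 * k1 * k2^-1).
    by apply: (uM); [exact: (uM) | exact: uV].
  by rewrite /k2 /k1 mkV !mkM mulgV mul1g /mk !subr0 !addr0; congr (((_, _), _), _).
have ua : generated u (mk 2%R 0%R 0%R 1).
  rewrite (_ : mk _ _ _ _ = k1 * (mk (-1)%R 0%R 0%R x0^-1)^-1).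
    by apply: (uM) => //; exact: uV.
  by rewrite /k1 mkV !mkM invgK mulVg /mk !addr0 ?oppr0; congr (((_, _), _), _).
have ux : generated u (mk 0%R 0%R 0%R (x0 * x0)).
  rewrite (_ : mk _ _ _ _ = (k1 * mk (-1)%R 0%R 0%R x0^-1)^-1).
    by apply: (uV); exact: (uM).
  by rewrite /k1 !mkM mkV invgM !invgK /mk !addr0 ?oppr0; congr (((_, _), _), _).
have ub : generated u (mk 0%R 2%R 0%R 1).
  rewrite (_ : mk _ _ _ _ = k2 * k2 * (mk 0%R 0%R 0%R (x0 * x0))^-1).
    by apply: (uM); [exact: (uM) | exact: uV].
  by rewrite /k2 mkV !mkM mulgV /mk !addr0 ?oppr0; congr (((_, _), _), _).
have int_gen (h : int -> G) : {morph h : i j / (i + j)%R >-> i * j} ->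
    generated u (h 1%R) -> forall i, generated u (h i).
  move=> hM h1 i; rewrite -(expz_int i).
  apply: (@subgroup_expz Zgrp (h @^-1` generated u)) => //.
  exact: (@subgroup_preim Zgrp G h hM).
have uaX i : generated u (mk (2 * i)%R 0%R 0%R 1).
  apply: (int_gen (fun i => mk (2 * i)%R 0%R 0%R 1)) => // z w.
  by rewrite mkM mulrDr mulg1 !addr0 /twist dvdz0.
have ubX i : generated u (mk 0%R (2 * i)%R 0%R 1).
  apply: (int_gen (fun i => mk 0%R (2 * i)%R 0%R 1)) => // z w.
  by rewrite mkM mulrDr mulg1 !addr0 /twist; case: ifP.
have ude e : generated u (mk 0%R 0%R e 1).
  by case: (F2_cases e) => -> //; exact: generated1.
(* The map y -> a^(pi y) y is a homomorphism, so it is enough to treat generators of [X]: [x0] goes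
   to (a x0^-1) x0^2 and [t j] to itself. *)
have uy y : generated u (mk (pi y) 0%R 0%R y).
  pose h y := mk (pi y) 0%R 0%R y.
  have hM : {morph h : y z / y * z} by move=> y1 y2; rewrite /h mkM piM !addr0 /twist dvdz0.
  have : [set: X] y by [].
  rewrite -tX; move: y; apply: (generated_min (subgroup_preim hM uG)) => y.
  rewrite inE => /orP[/eqP ->|/mapP[j _ ->]]; rewrite /preimage /= /h.
    rewrite pix0 (_ : mk _ _ _ _ = k1 * mk 0%R 0%R 0%R (x0 * x0)); first exact: uM.
    by rewrite /k1 mkM mulKg !addr0.
  by rewrite pit; exact: ut.
have HK : Fix phi `<=` generated u.
  move=> x /FixE2[m [n [bE aE]]].
  (* With i + pi y = 2n, the exponent i splits as 2 (n - pi y) + pi y. *)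
  rewrite (_ : x = mk (2 * (n - px x))%R 0%R 0%R 1 * mk (pi x.2) 0%R 0%R x.2
      * mk 0%R (2 * m)%R 0%R 1 * mk 0%R 0%R (de x) 1); last first.
    rewrite !mkM !mulg1 mul1g; case: x bE aE => -[[i j] e] y.
    rewrite /mk /ai /bj /de /px /= => -> aE; congr (((_, _), _), _).
    - by rewrite !addr0 !add0r /twist dvdz0; case: ifP; lia.
    - by rewrite !add0r addr0.
    - by rewrite !add0r.
  by apply: (uM) => //; apply: (uM) => //; apply: (uM).
have [s su sH] := (compressedP _ (mod2_free_fg Gf)).1 (GP phi phiM phi_bij) u HK.
(* Elements a x0^-1, a^2, b^2, d and [t j] of the fixed subgroup, with dual maps i, (i + pi y)/2,
   j/2 and e mod 2, and [chi j]. The halves are integers on the fixed subgroup; there b has even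
   exponent, so exponents of a add up. *)
pose I := (bool * bool + J)%type.
pose psi (k : I) (x : G) : 'F_2 := match k with
  | inl (false, false) => par (ai x)
  | inl (false, true) => par ((ai x + px x) %/ 2)%Z
  | inl (true, false) => par (bj x %/ 2)%Z
  | inl (true, true) => de x
  | inr j => chi j x.2 end.
pose y (k : I) : G := match k with
  | inl (false, false) => k1
  | inl (false, true) => mk 2%R 0%R 0%R 1
  | inl (true, false) => mk 0%R 2%R 0%R 1
  | inl (true, true) => k3
  | inr j => mk 0%R 0%R 0%R (t j) end.
have pi1 : (pi 1 : int) = 0%R := morph_1 piM.
have piV : (pi x0^-1 : int) = (- 1)%R.
  by rewrite (morph_V piM); have := pix0 => e; rewrite e.
have chi1 j : chi j 1 = 0%R.
  by apply: (@additive_on1 _ [set: X] _ _ (@subgroupT X)) => a b _ _; exact: (chiD j).1.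
have chiV j : chi j x0^-1 = 0%R.
  rewrite (@additive_onV _ [set: X] _ _ (@subgroupT X)) ?(chiD j).2 ?oppr0 //.
  by move=> a b _ _; exact: (chiD j).1.
have : (#|{: I}| <= size s)%N.
  apply: (@dual_size G I s psi y); rewrite ?sH.
  - move=> k x z /FixE2[m [n [bx ax]]] /FixE2[m' [n' [bz az]]].
    case: k => [[[] []]|j]; rewrite /psi.
    + exact: deM.
    + rewrite bjM -parD; congr par; rewrite bx bz; lia.
    + rewrite aiM pxM -parD; congr par; rewrite /twist bx dvdz_mulr //; lia.
    + by rewrite aiM parD /par twist_F2.
    + exact: (chiD j).1.
  - move=> k; apply/FixE; case: k => [[[] []]|j]; rewrite /y /ai /bj /px /=
      ?pi1 ?piV ?pit; split=> //.
  - move=> [[[] []]|j] [[[] []]|j']; rewrite /psi /y /ai /bj /px /de /=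
      ?pi1 ?piV ?pit ?chi1 ?chiV ?chit //.
(* The fixed subgroup needs 4 + |J| generators, whereas [u] has length 3 + |J|. *)
rewrite card_sum card_prod card_bool => /leq_trans/(_ su).
by rewrite /u /= size_map -cardE; lia.
Qed.

(** * Assembling the cases into the equivalence *)

Theorem theorem1p13 (n : nat) (hn : (0 < n)%N) (Gi : 'I_n -> groupType)
    (hGi : forall i : 'I_n, euclidean_surface_group (Gi i)) :
  let G : groupType := dprodg Gi in
  [<-> (forall phi : {multiplicative G -> G}, compressed (Fix phi));
       (forall phi : {multiplicative G -> G},
          bijective phi -> compressed (Fix phi));
       [\/ exists p q : nat, isog G (gpow Zgrp p * gpow C2 q)%type,
           exists q : nat, isog G (NS2 * gpow C2 q)%type
         | exists l p : nat,
             (1 <= l)%N /\ isog G (gpow NS2 l * gpow Zgrp p)%type]].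
Proof.
move=> G; have [l0 [p0 [q0 GE]]] := dprodg_normal_form hGi.
have Gf : mod2_free G.
  exact: mod2_free_isog (isog_sym GE) (mod2_free_normal_form _ _ _).
have klein_NS2 : isog klein NS2 by exact: isog_sym NS2_klein.
tfae.
- by move=> A phi _; exact: A.
- move=> B.
  have {B} GP : aut_Fix_compressed (normal_form l0 p0 q0).
    apply: aut_Fix_compressed_isog (mod2_free_normal_form _ _ _) (isog_sym GE) _.
    move=> phi phiM phi_bij.
    pose f := HB.pack_for {multiplicative G -> G} phi
      (isMultiplicative.Build G G phi phiM).
    exact: (B f phi_bij).
  (* A Klein factor, a C2 factor and a further factor [X] that is Z or Klein cannot occur together;
     the remaining factors are absorbed into [X]. *)
  have no X l p q : isog (normal_form l0 p0 q0)
      (prodg klein (prodg C2 (prodg X (normal_form l p q)))) ->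
      mod2_free_over_Z X -> False.
    move=> GX XZ; have := mod2_free_over_Z_prod XZ (mod2_free_normal_form l p q).
    move=> /not_aut_Fix_compressed; apply.
      apply: mod2_free_isog (mod2_free_normal_form l0 p0 q0).
      exact: isog_trans GX (isog_prodA _ _ _).
    have GX' := isog_sym (isog_trans GX (isog_prodA _ _ _)).
    apply: (aut_Fix_compressed_isog _ GX' GP).
    exact: mod2_free_isog (isog_sym GX') (mod2_free_normal_form _ _ _).
  (* With a C2 factor present, no Klein factor gives (euc1), and a single one without Z gives
     (euc2). A further Z or Klein factor is excluded by [no]. *)
  case: q0 => [|q] in GE GP no *; last first.
    case: l0 => [|l] in GE GP no *.
      apply: Or31; exists p0, q.+1; apply: isog_trans GE _.
      by apply: isog_prod (isog_refl _); exact: gpow0_isog.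
    case: p0 => [|p] in GE GP no *.
      case: l => [|l] in GE GP no *.
        apply: Or32; exists q.+1; apply: isog_trans GE _.
        apply: isog_prod (isog_refl _); apply: isog_trans (isog_prodC _ _) _.
        apply: isog_trans (gpow0_isog _ _) _; apply: isog_trans (gpow_split _ _) _.
        apply: isog_trans (isog_prodC _ _) _; apply: isog_trans (gpow0_isog _ _) _.
        exact: klein_NS2.
      exfalso; apply: (no klein l 0%N q _ mod2_free_over_Z_klein).
      apply: isog_trans (normal_form_klein _ _ _) _; apply: isog_prod (isog_refl _) _.
      apply: isog_trans (normal_form_C2 _ _ _) _; apply: isog_prod (isog_refl _) _.
      exact: normal_form_klein.
    exfalso; apply: (no Zgrp l p q _ mod2_free_over_Z_Z).
    apply: isog_trans (normal_form_klein _ _ _) _; apply: isog_prod (isog_refl _) _.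
    apply: isog_trans (normal_form_C2 _ _ _) _; apply: isog_prod (isog_refl _) _.
    exact: normal_form_Z.
  (* Without C2 factors, [l0 = 0] gives (euc1) with q = 0, and [l0 > 0] gives (euc4). *)
  have {}GE : isog G (prodg (gpow klein l0) (gpow Zgrp p0)).
    apply: isog_trans GE _; apply: isog_trans (isog_prodC _ _) _.
    exact: gpow0_isog.
  case: l0 => [|l] in GE GP no *.
    apply: Or31; exists p0, 0%N; apply: isog_trans GE _.
    apply: isog_trans (gpow0_isog _ _) _; apply: isog_sym.
    apply: isog_trans (isog_prodC _ _) _; exact: gpow0_isog.
  apply: Or33; exists l.+1, p0; split=> //; apply: isog_trans GE _.
  by apply: isog_prod (isog_refl _); exact: gpow_isog.
- move=> GC; suff GP : all_Fix_compressed G.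
    by move=> phi; apply: GP; exact: gmulfM.
  case: GC => [[p [q H]] | [q H] | [l [p [_ H]]]].
  + exact: all_Fix_compressed_isog Gf H (@all_Fix_compressed_euc1 p q).
  + apply: all_Fix_compressed_isog Gf _ (@all_Fix_compressed_euc2 q).
    apply: isog_trans H _; apply: isog_prod (isog_refl _); exact: NS2_klein.
  + apply: all_Fix_compressed_isog Gf _ (@all_Fix_compressed_euc4 l p).
    apply: isog_trans H _; apply: isog_prod (isog_refl _); apply: gpow_isog.
    exact: NS2_klein.
Qed.
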